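(* Suppose that $u_0\in C(\Gamma(0))$. Then there exists a unique viscosity solution to $$\partial^\bullet u(x,t)+H(x,t,\nabla_\Gamma u(x,t))=0\ \text{ for }(x,t)\in S_T,\qquad u(x,0)=u_0(x)\ \text{ for }x\in\Gamma(0).$$
   Context: Evolving surface. $\Gamma_0\subset\mathbb{R}^3$ is a closed (compact, without boundary), connected, oriented, smooth hypersurface, $T>0$, and $\Phi:\Gamma_0\times[0,T]\to\mathbb{R}^3$ is a smooth flow map such that $\Phi(\cdot,t)$ is a diffeomorphism of $\Gamma_0$ onto a hypersurface $\Gamma(t)$, with $\Phi(X,0)=X$ and $\partial_t\Phi(X,t)=v_\Gamma(\Phi(X,t),t)$; the velocity field satisfies $v_\Gamma\in C^1(\overline{S_T})$. Here $S_T=\bigcup_{t\in(0,T)}\Gamma(t)\times\{t\}$ and $\overline{S_T}=\bigcup_{t\in[0,T]}\Gamma(t)\times\{t\}\subset\mathbb{R}^4$. $\nu(\cdot,t)$ is the unit outward normal of $\Gamma(t)$ and $P_\Gamma=I_3-\nu\otimes\nu$. For differentiable $f$, $\nabla_\Gamma f=P_\Gamma\nabla\tilde f$ is the tangential gradient ($\tilde f$ any smooth extension of $f$ to a neighbourhood), and $\partial^\bullet f$ is the material derivative, $\partial^\bullet f(\Phi(X,t),t)=\frac{d}{dt}\bigl(f(\Phi(X,t),t)\bigr)$, equivalently $\partial^\bullet f=\partial_t\tilde f+v_\Gamma\cdot\nabla\tilde f$. Hamiltonian. $H:\overline{S_T}\times\mathbb{R}^3\to\mathbb{R}$ satisfies,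 with positive constants $L_{H,1},L_{H,2}$, for all $(x,t),(y,s)\in\overline{S_T}$, $p,q\in\mathbb{R}^3$: $|H(x,t,p)-H(y,s,p)|\le L_{H,1}(|x-y|+|t-s|)(1+|p|)$ and $|H(x,t,p)-H(x,t,q)|\le L_{H,2}|p-q|$. Viscosity solutions. $USC(\overline{S_T})$, $LSC(\overline{S_T})$ denote the upper, lower semicontinuous functions on $\overline{S_T}$. A locally bounded $u\in USC(\overline{S_T})$ (resp. $u\in LSC(\overline{S_T})$) is a viscosity subsolution (resp. supersolution) if $u(x,0)\le u_0(x)$ (resp. $u(x,0)\ge u_0(x)$) for all $x\in\Gamma(0)$ and, for any $\varphi\in C^1(\overline{S_T})$, whenever $u-\varphi$ takes a local maximum (resp. minimum) at $(x_0,t_0)\in\overline{S_T}$ with $t_0>0$ (so $t_0=T$ is allowed), then $\partial^\bullet\varphi(x_0,t_0)+H(x_0,t_0,\nabla_\Gamma\varphi(x_0,t_0))\le0$ (resp. $\ge0$). A viscosity solution is a function that is both a viscosity subsolution and a viscosity supersolution. *)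

(* Defs.v *)
From HB Require Import structures.
From mathcomp Require Import all_boot all_order all_algebra.
From mathcomp Require Import all_classical all_reals all_analysis.
Set Implicit Arguments.
Unset Strict Implicit.
Unset Printing Implicit Defensive.
Import Order.TTheory GRing.Theory Num.Theory.
Import numFieldNormedType.Exports.
Local Open Scope classical_set_scope.
Local Open Scope ring_scope.

(* The library norm of 'rV[R]_n is the sup norm, so the Euclidean structure of
   R^3 is introduced here. Both norms induce the same topology. *)
Definition dotp (R : realType) (x y : 'rV[R]_3) : R := \sum_(i < 3) x 0 i * y 0 i.

Definition enorm (R : realType) (x : 'rV[R]_3) : R := Num.sqrt (dotp x x).

Definition grad (R : realType) (f : 'rV[R]_3 -> R) (x : 'rV[R]_3) : 'rV[R]_3 :=
  \row_(j < 3) 'D_(delta_mx 0 j) f x.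

(* f is of class C^k on the open set U *)
Fixpoint Ck (R : realType) (V W : normedModType R) (k : nat) (U : set V)
    (f : V -> W) : Prop :=
  match k with
  | 0 => forall x, U x -> {for x, continuous f}
  | k'.+1 => (forall x, U x -> differentiable f x) /\
             (forall w : V, Ck k' U ('D_w f))
  end.

(* Functions on a subset A of a normed space are represented by total functions
   whose values outside A are irrelevant; being C^k on A means having a C^k
   extension to an open neighbourhood of A. *)
Definition Ck_extension (R : realType) (V W : normedModType R) (k : nat)
    (A : set V) (f g : V -> W) : Prop :=
  exists U : set V, [/\ open U, A `<=` U, Ck k U g & forall x, A x -> g x = f x].

Definition Ck_on (R : realType) (V W : normedModType R) (k : nat)
    (A : set V) (f : V -> W) : Prop :=
  exists g : V -> W, Ck_extension k A f g.

Definition smooth_on (R : realType) (V W : normedModType R)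
    (A : set V) (f : V -> W) : Prop :=
  exists g : V -> W, exists U : set V,
    [/\ open U, A `<=` U, forall k, Ck k U g & forall x, A x -> g x = f x].

(* Derivative of g at t relative to A; one-sided at the endpoints of an
   interval A. *)
Definition is_derive_within (R : realType) (W : normedModType R) (A : set R)
    (g : R -> W) (t : R) (d : W) : Prop :=
  (s - t)^-1 *: (g s - g t) @[s --> within A (t^')] --> d.

Definition diffeomorphism (R : realType) (A B : set 'rV[R]_3)
    (f : 'rV[R]_3 -> 'rV[R]_3) : Prop :=
  set_bij A B f /\ smooth_on A f /\
  exists g : 'rV[R]_3 -> 'rV[R]_3,
    smooth_on B g /\ (forall x, A x -> g (f x) = x).

Definition smooth_hypersurface (R : realType) (G : set 'rV[R]_3) : Prop :=
  forall x, G x -> exists (U : set 'rV[R]_3) (f : 'rV[R]_3 -> R),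
    [/\ open U, U x, forall k, Ck k U f,
        forall y, (U `&` G) y -> grad f y != 0
      & U `&` G = U `&` [set y | f y = 0]].

(* compact without boundary, and connected *)
Definition closed_hypersurface (R : realType) (G : set 'rV[R]_3) : Prop :=
  [/\ G !=set0, smooth_hypersurface G, compact G & connected G].

(* w is the velocity at x of a curve contained in G *)
Definition tangent_vector (R : realType) (G : set 'rV[R]_3) (x w : 'rV[R]_3) : Prop :=
  exists c : R -> 'rV[R]_3,
    [/\ c 0 = x, \forall s \near 0, G (c s) & is_derive (0 : R) (1 : R) c w].

(* the unbounded part of the complement of G *)
Definition exterior (R : realType) (G : set 'rV[R]_3) : set 'rV[R]_3 :=
  [set x | ~ G x /\ ~ bounded_set (connected_component (~` G) x)].

(* Continuity of n is the orientation of G; the last clause says that n points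
   out of the region enclosed by G. *)
Definition unit_outward_normal (R : realType) (G : set 'rV[R]_3)
    (n : 'rV[R]_3 -> 'rV[R]_3) : Prop :=
  {within G, continuous n} /\
  forall x, G x ->
    [/\ enorm (n x) = 1,
        forall w, tangent_vector G x w -> dotp (n x) w = 0
      & \forall s \near (0 : R)^'+, exterior G (x + s *: n x)].

(* P p with P = I - n (x) n *)
Definition tangential_proj (R : realType) (n p : 'rV[R]_3) : 'rV[R]_3 :=
  p - dotp n p *: n.

(* g is the tangential gradient at x of the function f on G, where n is a unit
   normal to G at x *)
Definition is_tangential_gradient (R : realType) (G : set 'rV[R]_3)
    (n : 'rV[R]_3) (f : 'rV[R]_3 -> R) (x g : 'rV[R]_3) : Prop :=
  exists2 ft : 'rV[R]_3 -> R,
    Ck_extension 1 G f ft & g = tangential_proj n (grad ft x).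

Definition surface (R : realType) (G0 : set 'rV[R]_3)
    (Phi : 'rV[R]_3 -> R -> 'rV[R]_3) (t : R) : set 'rV[R]_3 :=
  [set Phi X t | X in G0].

(* the closure of S_T *)
Definition spacetime (R : realType) (G0 : set 'rV[R]_3) (T : R)
    (Phi : 'rV[R]_3 -> R -> 'rV[R]_3) : set ('rV[R]_3 * R) :=
  [set z | 0 <= z.2 <= T /\ surface G0 Phi z.2 z.1].

Record evolving_surface (R : realType) (G0 : set 'rV[R]_3) (T : R)
    (Phi : 'rV[R]_3 -> R -> 'rV[R]_3) (v : 'rV[R]_3 * R -> 'rV[R]_3)
    (nu : 'rV[R]_3 -> R -> 'rV[R]_3) : Prop := EvolvingSurface {
  es_closed : closed_hypersurface G0;
  es_time : 0 < T;
  es_flow_smooth :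
    smooth_on (G0 `*` `[0, T]) (fun z : 'rV[R]_3 * R => Phi z.1 z.2);
  es_surface : forall t, 0 <= t <= T -> smooth_hypersurface (surface G0 Phi t);
  es_flow_diffeo : forall t, 0 <= t <= T ->
    diffeomorphism G0 (surface G0 Phi t) (Phi^~ t);
  es_flow_init : forall X, G0 X -> Phi X 0 = X;
  es_velocity : forall X t, G0 X -> 0 <= t <= T ->
    is_derive_within `[0, T] (Phi X) t (v (Phi X t, t));
  es_velocity_C1 : Ck_on 1 (spacetime G0 T Phi) v;
  es_normal : forall t, 0 <= t <= T ->
    unit_outward_normal (surface G0 Phi t) (nu^~ t)
}.

(* d is the derivative of f along the trajectory through z *)
Definition is_material_derivative (R : realType) (G0 : set 'rV[R]_3) (T : R)
    (Phi : 'rV[R]_3 -> R -> 'rV[R]_3) (f : 'rV[R]_3 * R -> R)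
    (z : 'rV[R]_3 * R) (d : R) : Prop :=
  exists X, [/\ G0 X, Phi X z.2 = z.1
    & is_derive_within `[0, T] (fun s => f (Phi X s, s)) z.2 d].

Definition hamiltonian_conditions (R : realType) (S : set ('rV[R]_3 * R))
    (H : 'rV[R]_3 * R -> 'rV[R]_3 -> R) (L1 L2 : R) : Prop :=
  (forall z w p, S z -> S w ->
     `|H z p - H w p| <= L1 * (enorm (z.1 - w.1) + `|z.2 - w.2|) * (1 + enorm p)) /\
  (forall z p q, S z -> `|H z p - H z q| <= L2 * enorm (p - q)).

Definition lsc_on (R : realType) (V : topologicalType) (A : set V) (u : V -> R) : Prop :=
  lower_semicontinuous ((EFin \o u) : subspace A -> \bar R).

Definition usc_on (R : realType) (V : topologicalType) (A : set V) (u : V -> R) : Prop :=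
  lsc_on A (fun x => - u x).

Definition locally_bounded_on (R : realType) (V : topologicalType) (A : set V)
    (u : V -> R) : Prop :=
  forall z, A z -> exists M : R, \forall w \near within A (nbhs z), `|u w| <= M.

Definition local_max_on (R : realType) (V : topologicalType) (A : set V)
    (f : V -> R) (z : V) : Prop :=
  A z /\ \forall w \near within A (nbhs z), f w <= f z.

Definition local_min_on (R : realType) (V : topologicalType) (A : set V)
    (f : V -> R) (z : V) : Prop :=
  A z /\ \forall w \near within A (nbhs z), f z <= f w.

Definition viscosity_subsolution (R : realType) (G0 : set 'rV[R]_3) (T : R)
    (Phi : 'rV[R]_3 -> R -> 'rV[R]_3) (nu : 'rV[R]_3 -> R -> 'rV[R]_3)
    (H : 'rV[R]_3 * R -> 'rV[R]_3 -> R) (u0 : 'rV[R]_3 -> R)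
    (u : 'rV[R]_3 * R -> R) : Prop :=
  let S := spacetime G0 T Phi in
  [/\ locally_bounded_on S u, usc_on S u,
      forall x, surface G0 Phi 0 x -> u (x, 0) <= u0 x
    & forall phi : 'rV[R]_3 * R -> R, Ck_on 1 S phi ->
      forall x0 t0, 0 < t0 -> local_max_on S (fun z => u z - phi z) (x0, t0) ->
      forall d g,
        is_material_derivative G0 T Phi phi (x0, t0) d ->
        is_tangential_gradient (surface G0 Phi t0) (nu x0 t0)
          (fun x => phi (x, t0)) x0 g ->
        d + H (x0, t0) g <= 0].

Definition viscosity_supersolution (R : realType) (G0 : set 'rV[R]_3) (T : R)
    (Phi : 'rV[R]_3 -> R -> 'rV[R]_3) (nu : 'rV[R]_3 -> R -> 'rV[R]_3)
    (H : 'rV[R]_3 * R -> 'rV[R]_3 -> R) (u0 : 'rV[R]_3 -> R)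
    (u : 'rV[R]_3 * R -> R) : Prop :=
  let S := spacetime G0 T Phi in
  [/\ locally_bounded_on S u, lsc_on S u,
      forall x, surface G0 Phi 0 x -> u0 x <= u (x, 0)
    & forall phi : 'rV[R]_3 * R -> R, Ck_on 1 S phi ->
      forall x0 t0, 0 < t0 -> local_min_on S (fun z => u z - phi z) (x0, t0) ->
      forall d g,
        is_material_derivative G0 T Phi phi (x0, t0) d ->
        is_tangential_gradient (surface G0 Phi t0) (nu x0 t0)
          (fun x => phi (x, t0)) x0 g ->
        0 <= d + H (x0, t0) g].

Definition viscosity_solution (R : realType) (G0 : set 'rV[R]_3) (T : R)
    (Phi : 'rV[R]_3 -> R -> 'rV[R]_3) (nu : 'rV[R]_3 -> R -> 'rV[R]_3)
    (H : 'rV[R]_3 * R -> 'rV[R]_3 -> R) (u0 : 'rV[R]_3 -> R)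
    (u : 'rV[R]_3 * R -> R) : Prop :=
  viscosity_subsolution G0 T Phi nu H u0 u /\
  viscosity_supersolution G0 T Phi nu H u0 u.

(* Main.v *)
(* Uniqueness follows from a comparison principle proved by doubling the
   space-time variables with the penalty k (|x - y|^2 + (t - s)^2).  The gradient
   p = 2k(x - y) enters the two equations through the tangential projections at
   two different points, so the argument needs the projection I - n (x) n to be
   locally Lipschitz on the space-time surface.  This comes from transporting
   tangent vectors along the flow: a vector tangent at one point is pulled back
   to the initial surface, corrected to be tangent at a nearby point, and pushed
   forward, all with Lipschitz control.  Existence is Perron's method: the
   supremum of the subsolutions has a subsolution as upper envelope, and its
   lower envelope is a supersolution because a subsolution that is not a
   supersolution can be raised locally; comparison identifies the two envelopes.
   Barriers c -/+ (K (|x - y|^2 + t^2) + C t) give the initial values. *)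
Require Import Defs.
From mathcomp Require Import all_boot all_order all_algebra.
From mathcomp Require Import all_classical all_reals all_analysis.
From mathcomp Require Import ring lra.
Set Implicit Arguments.
Unset Strict Implicit.
Unset Printing Implicit Defensive.
Import Order.TTheory GRing.Theory Num.Theory.
Import numFieldNormedType.Exports.
Local Open Scope classical_set_scope.
Local Open Scope ring_scope.

(** * Semicontinuous functions *)

(** The viscosity argument is abstract: it needs a compact set, a penalty comparable to the squared
    norm and an operator [E] with four properties, so the geometry is confined to verifying these.
    The decisive one is [E_double]. At maximum points of the doubled problem k |z - w|^2 can be made
    small, while k |z - w|, the size of the gradient, is not controlled. Hence every coefficient,
    the projection included, must vary by O(|z - w|); mere continuity would not do. The obstacle is
    that [nu] is only assumed continuous on each surface separately, with nothing said about its
    dependence on time, so the bound in space and time has to be drawn from the flow. The final time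
    is harmless because trajectories can be followed backwards: a maximum then gives a one-sided
    derivative inequality, of exactly the sign that ellipticity asks for. The norm of the library is
    the sup norm; factors such as 2, 3 and 4 come from comparing it with the Euclidean one, and
    constants are not optimised. *)

Definition usc_within (R : realType) (T : topologicalType) (A : set T)
    (f : T -> R) : Prop :=
  forall x, A x -> forall e, 0 < e ->
    \forall y \near within A (nbhs x), f y < f x + e.

Lemma usc_onP (R : realType) (T : topologicalType) (A : set T) (f : T -> R) :
  usc_on A f <-> usc_within A f.
Proof.
split.
- move=> uf x Ax e e0.
  have ex : ((- f x - e)%:E < (- f x)%:E)%E by rewrite lte_fin ltrBlDr ltrDl.
  have [V nV Vf] := uf x _ ex.
  have nV' : within A (nbhs x) V by rewrite nbhs_subspace_in.
  by apply: filterS nV' => y /Vf; rewrite /= lte_fin; lra.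
- move=> uf x a /=; rewrite lte_fin => ax.
  have [Ax|nAx] := pselect (A x).
    have e0 : 0 < - f x - a by lra.
    exists (fun y => f y < f x + (- f x - a)).
      by have := uf _ Ax _ e0; rewrite nbhs_subspace_in.
    by move=> y /=; rewrite lte_fin; lra.
  (* The subspace topology makes every point outside [A] isolated, so a singleton is a
     neighbourhood. *)
  exists [set x]; last by move=> y -> /=; rewrite lte_fin.
  by case: (@nbhs_subspaceP T A x) => // _ y ->.
Qed.

Lemma lsc_onP (R : realType) (T : topologicalType) (A : set T) (f : T -> R) :
  lsc_on A f <-> usc_within A (fun x => - f x).
Proof.
rewrite -usc_onP /usc_on.
suff -> : (fun x => - - f x) = f by [].
by apply/funext => x; rewrite opprK.
Qed.

Lemma near_withinP (R : realType) (V : normedModType R) (A : set V) (z : V)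
    (P : V -> Prop) :
  (\forall w \near within A (nbhs z), P w) <->
  exists2 r : R, 0 < r & forall w, A w -> `|w - z| < r -> P w.
Proof.
rewrite near_withinE; split.
- move=> /nbhs_normP[r /= r0 rP]; exists r => // w Aw zw.
  by apply: rP => //=; rewrite distrC.
- move=> [r r0 rP]; apply/nbhs_normP; exists r => // w /= zw Aw.
  by apply: rP => //; rewrite distrC.
Qed.

Lemma usc_within_comp (R : realType) (T U : topologicalType) (A : set T)
    (B : set U) (g : U -> T) (f : T -> R) :
  usc_within A f -> (forall x, B x -> A (g x)) -> continuous g ->
  usc_within B (f \o g).
Proof.
move=> uf BA cg x Bx e e0; have := cg x _ (uf _ (BA _ Bx) _ e0).
by rewrite /nbhs /=; apply: filterS => y /= H /BA.
Qed.

Lemma continuous_usc (R : realType) (T : topologicalType) (A : set T) (f : T -> R) :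
  (forall x, A x -> {for x, continuous f}) -> usc_within A f.
Proof.
move=> cf x Ax e e0; apply: cvg_within.
have /cvgrPdist_lt/(_ _ e0) := cf x Ax.
by apply: filterS => y; rewrite ltr_distlC => /andP[_ ?]; lra.
Qed.

Lemma usc_withinD (R : realType) (T : topologicalType) (A : set T) (f g : T -> R) :
  usc_within A f -> usc_within A g -> usc_within A (f \+ g).
Proof.
move=> uf ug x Ax e e0; have e20 : 0 < e / 2 by rewrite divr_gt0.
apply: filterS2 (uf x Ax _ e20) (ug x Ax _ e20) => y /=.
by lra.
Qed.

(** The superlevel sets of [f] at its own values form a filter base, because the values are totally
    ordered. A cluster point of this filter is a maximum point: near it [f] exceeds its value there
    by less than [e], yet takes values at least [f y] for each [y]. *)
Lemma usc_max (R : realType) (T : topologicalType) (A : set T) (f : T -> R) :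
  compact A -> A !=set0 -> usc_within A f ->
  exists2 x, A x & forall y, A y -> f y <= f x.
Proof.
move=> cA [a Aa] uf.
pose F := filter_from A (fun y => [set x | A x /\ f y <= f x]).
have FF : ProperFilter F.
  apply: filter_from_proper; last by move=> y Ay; exists y.
  apply: filter_from_filter; first by exists a.
  move=> x y Ax Ay; have [xy|/ltW yx] := leP (f x) (f y).
  - by exists y => // z /= [Az yz]; split; split=> //; exact: le_trans yz.
  - by exists x => // z /= [Az xz]; split; split=> //; exact: le_trans xz.
have FA : F A by exists a => // x [].
have [x [Ax clx]] := cA F FF FA.
exists x => // y Ay; apply/ler_addgt0Pr => e e0.
have Fy : F [set x | A x /\ f y <= f x] by exists y.
have [z [[Az yz] /(_ Az) zx]] := clx _ _ Fy (uf x Ax e e0).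
exact: le_trans yz (ltW zx).
Qed.

Lemma global_max_on (R : realType) (T : topologicalType) (A : set T)
    (f : T -> R) x : A x -> (forall y, A y -> f y <= f x) -> local_max_on A f x.
Proof. by move=> Ax fx; split => //; rewrite near_withinE; apply: nearW. Qed.

Lemma global_min_on (R : realType) (T : topologicalType) (A : set T)
    (f : T -> R) x : A x -> (forall y, A y -> f x <= f y) -> local_min_on A f x.
Proof. by move=> Ax fx; split => //; rewrite near_withinE; apply: nearW. Qed.

(** * Comparison and Perron's method *)

(* In this section tm is the time, q the squared distance used as penalty, C the
   class of test functions, and E phi z the value at z of the left-hand side of
   the equation for phi.  E_max expresses ellipticity up to the final time, and
   E_double is the estimate that makes the doubling of variables work. *)
Section Viscosity.
Context (R : realType) (V : normedModType R) (S : set V) (tm : V -> R).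
Context (q : V -> V -> R) (C : set (V -> R)) (E : (V -> R) -> V -> R).

Definition paraboloid (k : R) (z0 : V) (l c : R) : V -> R :=
  fun z => k * q z z0 + l * tm z + c.

Hypothesis cS : compact S.
Hypothesis tm_ge0 : forall z, S z -> 0 <= tm z.
Hypothesis tm_lip : forall z w, `|tm z - tm w| <= `|z - w|.
Hypothesis q_sym : forall z w, q z w = q w z.
Hypothesis q_ge : forall z w, `|z - w| ^+ 2 <= q z w.
Hypothesis q_le : forall z w, q z w <= 4 * `|z - w| ^+ 2.
Hypothesis q_cont : continuous (fun p : V * V => q p.1 p.2).
Hypothesis C_cont : forall phi, C phi -> forall z, S z -> {for z, continuous phi}.
Hypothesis C_quad : forall k z0 l c, C (paraboloid k z0 l c).
Hypothesis C_add : forall phi psi, C phi -> C psi -> C (phi \+ psi).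
Hypothesis E_cont : forall phi, C phi -> forall z, S z -> forall e : R, 0 < e ->
  \forall w \near within S (nbhs z), `|E phi w - E phi z| < e.
(** Under either alternative the derivative of the quadratic part vanishes at [z], so only the time
    slope [l] is felt. *)
Hypothesis E_quad : forall phi k z0 l c z, C phi -> S z -> k = 0 \/ z = z0 ->
  E (phi \+ paraboloid k z0 l c) z = E phi z + l.
Hypothesis E_max : forall phi psi z, C phi -> C psi -> 0 < tm z ->
  local_max_on S (fun w => psi w - phi w) z -> E phi z <= E psi z.
Hypothesis E_double : forall z0, S z0 -> exists K r : R, [/\ 0 < K, 0 < r &
  forall (z w : V) (k l : R), S z -> S w -> `|z - z0| < r -> `|w - z0| < r -> 0 <= k ->
    E (paraboloid (- k) z 0 0) w + l - E (paraboloid k w l 0) z <=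
      K * (k * `|z - w| ^+ 2 + `|z - w|)].

Definition subsol (u : V -> R) : Prop :=
  usc_within S u /\
  forall phi, C phi -> forall z, 0 < tm z ->
    local_max_on S (fun w => u w - phi w) z -> E phi z <= 0.

Definition supersol (u : V -> R) : Prop :=
  usc_within S (fun z => - u z) /\
  forall phi, C phi -> forall z, 0 < tm z ->
    local_min_on S (fun w => u w - phi w) z -> 0 <= E phi z.

Lemma q_ge0 z w : 0 <= q z w.
Proof. by apply: le_trans (q_ge z w); rewrite exprn_ge0. Qed.

Lemma qxx z : q z z = 0.
Proof.
apply/eqP; rewrite eq_le q_ge0 andbT.
by apply: le_trans (q_le z z) _; rewrite subrr normr0 expr0n mulr0.
Qed.

Lemma quad_usc k y l c : usc_within S (paraboloid k y l c).
Proof. by apply: continuous_usc; exact: C_cont. Qed.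

Lemma tm_cont : continuous tm.
Proof.
move=> z; apply/cvgrPdist_lt => e e0; near=> w.
apply: le_lt_trans (tm_lip _ _) _; near: w.
exact: cvgr_dist_lt.
Unshelve. all: by end_near. Qed.

Lemma compact_bounded_above (u : V -> R) : usc_within S u ->
  exists M, forall z, S z -> u z <= M.
Proof.
move=> uu; have [S0|/set0P S0] := eqVneq S set0; first by exists 0 => z; rewrite S0.
by have [x _ xM] := usc_max cS S0 uu; exists (u x).
Qed.

(** At a maximum of u(a) - w(b) - k q(a, b) - l tm(a) two paraboloids are admissible tests, giving E
    <= 0 at a and E >= 0 at b. [E_double] then bounds the fixed slope [l] by a quantity that can be
    made arbitrarily small. *)
Lemma comparison u w : subsol u -> supersol w ->
  (forall z, S z -> tm z = 0 -> u z <= w z) -> forall z, S z -> u z <= w z.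
Proof.
move=> [uu su] [lw sw] uw0 z1 Sz1; rewrite leNgt; apply/negP => wu1.
(* [u - l tm] is a strict subsolution and still exceeds [w] somewhere. *)
pose l := (u z1 - w z1) / (2 * (tm z1 + 1)).
have t1 := tm_ge0 Sz1.
have l0 : 0 < l by rewrite divr_gt0 ?mulr_gt0//; lra.
have lE : l * (2 * (tm z1 + 1)) = u z1 - w z1.
  by rewrite /l mulfVK//; apply: lt0r_neq0; lra.
have uquad k y m : usc_within S (fun z => - paraboloid k y m 0 z).
  have := @quad_usc (- k) y (- m) 0; congr usc_within.
  by apply/funext => z; rewrite /paraboloid; ring.
have [zm Szm zmP] : exists2 x, S x & forall y, S y ->
    u y + - w y + - paraboloid 0 x l 0 y <= u x + - w x + - paraboloid 0 x l 0 x.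
  have uall : usc_within S (fun y => u y + - w y + - paraboloid 0 z1 l 0 y).
    by do 2![apply: usc_withinD => //].
  have [|x Sx xP] := usc_max cS _ uall; first by exists z1.
  by exists x => // y /xP; rewrite /paraboloid; lra.
pose m := u zm - w zm - l * tm zm.
have mP y : S y -> u y - w y - l * tm y <= m.
  by move=> /zmP; rewrite /paraboloid /m; lra.
have m0 : 0 < m by have := mP _ Sz1; nra.
have /choice[p pP] : forall k : nat, exists p : V * V, [/\ S p.1, S p.2 &
   forall a b, S a -> S b -> u a - w b - k%:R * q a b - l * tm a <=
     u p.1 - w p.2 - k%:R * q p.1 p.2 - l * tm p.1].
  move=> k.
  have upsi : usc_within (S `*` S) (fun p : V * V =>
      u p.1 + - w p.2 + (- k%:R * q p.1 p.2 - l * tm p.1)).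
    apply: usc_withinD; first apply: usc_withinD.
    + by apply: (usc_within_comp (g := fst) uu) => [x []//|x]; exact: cvg_fst.
    + by apply: (usc_within_comp (g := snd) lw) => [x []//|x]; exact: cvg_snd.
    + apply: continuous_usc => x _; apply: cvgB.
        by apply: cvgMr; exact: q_cont.
      apply: cvgMr; apply: (@continuous_comp _ _ _ fst tm); first exact: cvg_fst.
      exact: tm_cont.
  have [|p [Sp1 Sp2] pP] := usc_max (compact_setX cS cS) _ upsi.
    by exists (z1, z1).
  exists p; split => // a b Sa Sb.
  by have := pP (a, b) (conj Sa Sb) => /=; lra.
(* A cluster point of the maximum points replaces a convergent subsequence: through [get], each
   later step needs only a single index [k] that is large enough or close enough. *)
have [[zs ws] [[/= Szs Sws] clp]] : (S `*` S) `&` cluster (p @ \oo) !=set0.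
  apply: compact_setX => //.
  by exists 0%N => // k _ /=; have [] := pP k.
have get (N : nat) (r : R) : 0 < r -> exists k : nat,
    [/\ (N <= k)%N, `|(p k).1 - zs| < r & `|(p k).2 - ws| < r].
  move=> r0.
  have F1 : (p @ \oo) [set p k | k in [set k | (N <= k)%N]].
    by exists N => // k /= Nk; exists k.
  have F2 : nbhs (zs, ws) (fun x : V * V => `|x.1 - zs| < r /\ `|x.2 - ws| < r).
    exists (ball zs r, ball ws r); first by split; exact: nbhsx_ballx.
    by move=> x [/=]; rewrite -!ball_normE /= ![`|_ - x.1|]distrC ![`|_ - x.2|]distrC.
  have [_ [[k /= Nk <-] [? ?]]] := clp _ _ F1 F2.
  by exists k.
have [Mu uM] := compact_bounded_above uu.
have [Mw wM] := compact_bounded_above lw.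
have pm k : m <= u (p k).1 - w (p k).2 - k%:R * q (p k).1 (p k).2 - l * tm (p k).1.
  by have [_ _ /(_ zm zm Szm Szm)] := pP k; rewrite qxx /m; lra.
(* The penalty forces the cluster point of the maximum points to the diagonal. *)
have zsws : zs = ws.
  apply/eqP; apply: contraT => zw.
  have d0 : 0 < `|zs - ws| by rewrite normr_gt0 subr_eq0.
  set d := `|zs - ws| in d0.
  (* This [k] exceeds 4 (Mu + Mw) / d^2, so |a - b| > d / 2 would make the penalty larger than Mu +
     Mw, while a positive maximum allows no more than that. *)
  have [k [Nk ak bk]] := get (Num.truncn ((Mu + Mw) * 4 / d ^+ 2)).+1 (d / 4) ltac:(lra).
  have [Sa Sb _] := pP k; have := pm k; set a := (p k).1; set b := (p k).2 => mk.
  have kM : k%:R * `|a - b| ^+ 2 < Mu + Mw.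
    have := ler_wpM2l (ler0n R k) (q_ge a b); have := uM _ Sa; have := wM _ Sb.
    by have := mulr_ge0 (ltW l0) (tm_ge0 Sa); rewrite -/a -/b; lra.
  have dab : d / 2 < `|a - b|.
    have := ler_distD a zs ws; have := ler_distD b a ws.
    by rewrite (distrC zs a) -/d -/a -/b; move: ak bk; rewrite -/a -/b; lra.
  have kN : (Mu + Mw) * 4 / d ^+ 2 < k%:R.
    by apply: lt_le_trans (truncnS_gt _) _; rewrite ler_nat.
  move: kN; rewrite ltr_pdivrMr ?exprn_gt0// => kN.
  have : (d / 2) ^+ 2 <= `|a - b| ^+ 2 by rewrite lerXn2r ?nnegrE//; lra.
  have := ler0n R k; nra.
rewrite -{ws}zsws in Sws clp get *.
have [K [r [K0 r0 Kr]]] := E_double Szs.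
(* At the chosen index the penalty will be at most 3e and |a - b| at most 2e, so [E_double] yields l
   <= 5 K e, against 6 K e <= l. The bound m / 4 excludes a cluster point at the initial time, where
   semicontinuity and u <= w would give m < 2e. *)
pose e := Num.min (l / (6 * K)) (m / 4).
have e0 : 0 < e.
  by rewrite lt_min; apply/andP; split; apply: divr_gt0 => //; exact: mulr_gt0.
have eK : 6 * K * e <= l.
  by rewrite mulrC -ler_pdivlMr ?mulr_gt0// ge_min lexx.
have em : 4 * e <= m by rewrite mulrC -ler_pdivlMr// ge_min lexx orbT.
clearbody e.
have /near_withinP[ru ru0 ruP] := uu zs Szs e e0.
have /near_withinP[rw rw0 rwP] := lw zs Szs e e0.
have tzs : 0 < tm zs.
  rewrite lt0r tm_ge0// andbT; apply/eqP => t0.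
  have [k [_ ak bk]] := get 0 (Num.min ru rw) ltac:(by rewrite lt_min ru0).
  have [Sa Sb _] := pP k; have mk := pm k.
  rewrite !lt_min in ak bk; case/andP: ak => ak _; case/andP: bk => _ bk.
  have := ruP _ Sa ak; have := rwP _ Sb bk; have := uw0 _ Szs t0.
  have := mulr_ge0 (ltW l0) (tm_ge0 Sa).
  have := mulr_ge0 (ler0n R k) (q_ge0 (p k).1 (p k).2); lra.
(* The entry [tm zs] keeps both times positive, so that the tests apply; [e / l] makes the term l
   (tm zs - tm a) cost at most one [e] in the bound 3e for the penalty. *)
pose rho := Num.min (Num.min (Num.min ru rw) (Num.min r (tm zs))) (Num.min e (e / l)).
have rho0 : 0 < rho by rewrite !lt_min ru0 rw0 r0 tzs e0 divr_gt0.
have [k [_]] := get 0 rho rho0.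
have [Sa Sb abP] := pP k; have := pm k; set a := (p k).1; set b := (p k).2 => mk.
rewrite !lt_min => /andP[/andP[/andP[aru arw] /andP[ar at_]] /andP[ae ael]].
move=> /andP[/andP[/andP[bru brw] /andP[br bt]] /andP[be bel]].
have ta : 0 < tm a.
  by have := tm_lip a zs; rewrite ler_distl => /andP[? _]; lra.
have tb : 0 < tm b.
  by have := tm_lip b zs; rewrite ler_distl => /andP[? _]; lra.
have sub : E (paraboloid k%:R b l 0) a <= 0.
  apply: su => //; apply: global_max_on => // z Sz.
  by have := abP z b Sz Sb; rewrite /paraboloid -/a -/b; lra.
have sup : 0 <= E (paraboloid (- k%:R) a 0 0) b.
  apply: sw => //; apply: global_min_on => // z Sz.
  by have := abP a z Sa Sz; rewrite /paraboloid -/a -/b (q_sym z) (q_sym b); lra.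
have := Kr a b k%:R l Sa Sb ar br (ler0n _ _).
have kq : k%:R * `|a - b| ^+ 2 <= 3 * e.
  have := ler_wpM2l (ler0n R k) (q_ge a b); have := ruP _ Sa aru; have := rwP _ Sb brw.
  have := mP _ Szs; have := tm_lip a zs; rewrite ler_distl => /andP[? _].
  move: ael; rewrite ltr_pdivlMr// => ael; nra.
have ab : `|a - b| <= 2 * e.
  by have := ler_distD zs a b; rewrite (distrC zs b); lra.
nra.
Qed.

(** Ellipticity compares [E phi] with [E b] wherever [phi] touches [b] from above, so a classical
    subsolution passes every test, also at the final time. *)
Lemma C_subsol b : C b -> (forall z, S z -> E b z <= 0) -> subsol b.
Proof.
move=> Cb Eb; split; first by apply: continuous_usc; exact: C_cont.
move=> phi Cphi z tz mz; apply: le_trans (E_max Cphi Cb tz mz) (Eb _ _).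
by case: mz.
Qed.

Lemma C_supersol b : C b -> (forall z, S z -> 0 <= E b z) -> supersol b.
Proof.
move=> Cb Eb; split.
  by apply: continuous_usc => z Sz; apply: cvgN; exact: C_cont.
move=> phi Cphi z tz [Sz mz]; apply: le_trans (Eb _ Sz) _; apply: E_max => //.
by split => //; apply: filterS mz => w; lra.
Qed.

Lemma E_quadl k y l c z : S z -> E (paraboloid k y l c) z = E (paraboloid k y 0 0) z + l.
Proof.
move=> Sz; rewrite -(@E_quad _ 0 y l c) //; last by left.
by congr (E _ z); apply/funext => w; rewrite /paraboloid /=; ring.
Qed.

Lemma E_quad_bounded k y : exists M, forall z, S z -> `|E (paraboloid k y 0 0) z| <= M.
Proof.
have [M1 M1P] : exists M, forall z, S z -> E (paraboloid k y 0 0) z <= M.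
  apply: compact_bounded_above => z Sz e e0.
  apply: filterS (E_cont (C_quad k y 0 0) Sz e0) => w.
  by rewrite ltr_distl => /andP[_].
have [M2 M2P] : exists M, forall z, S z -> - E (paraboloid k y 0 0) z <= M.
  apply: compact_bounded_above => z Sz e e0.
  apply: filterS (E_cont (C_quad k y 0 0) Sz e0) => w.
  by rewrite ltr_distl => /andP[? _]; lra.
exists (Num.max M1 M2) => z Sz; rewrite ler_norml le_max lerNl le_max.
by rewrite M1P// M2P// orbT.
Qed.

(** The limsup of [f] at [z] along [S], the value at [z] included: for bounded [f] this is the upper
    semicontinuous envelope. Lower envelopes are obtained by two changes of sign. *)
Definition usc_env (f : V -> R) (z : V) : R :=
  inf [set c | \forall y \near within S (nbhs z), f y <= c].

Section Envelope.
Variables (f : V -> R) (M : R).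
Hypothesis fM : forall z, S z -> `|f z| <= M.

Lemma within_self (P : V -> Prop) z : S z ->
  (\forall y \near within S (nbhs z), P y) -> P z.
Proof. by move=> Sz /nbhs_singleton; apply. Qed.

Lemma env_le z c : S z -> (\forall y \near within S (nbhs z), f y <= c) ->
  usc_env f z <= c.
Proof.
move=> Sz; apply: ge_inf; exists (f z) => c' /= H.
exact: (within_self Sz H).
Qed.

Lemma env_lt z e : S z -> 0 < e ->
  \forall y \near within S (nbhs z), f y <= usc_env f z + e.
Proof.
move=> Sz e0; have [|c /= zc ce] := @inf_adherent _ [set c | \forall y \near within S (nbhs z), f y <= c] e e0.
  split; first by exists M; near=> y; apply: le_trans (ler_norm _) (fM _); near: y; exact: withinT.
  by exists (f z) => c' /= H; exact: (within_self Sz H).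
by apply: filterS zc => y /le_trans; apply; exact: ltW.
Unshelve. all: by end_near. Qed.

Lemma env_ge z : S z -> f z <= usc_env f z.
Proof.
move=> Sz; apply/ler_addgt0Pr => e e0.
exact: (within_self Sz (env_lt Sz e0)).
Qed.

Lemma env_usc : usc_within S (usc_env f).
Proof.
move=> z Sz e e0; have e20 : 0 < e / 2 by rewrite divr_gt0.
have /near_withinP[r r0 rP] := env_lt Sz e20.
apply/near_withinP; exists r => // w Sw wr.
apply: le_lt_trans (_ : usc_env f z + e / 2 < _); last by lra.
apply: env_le => //; apply/near_withinP; exists (r - `|w - z|); first by lra.
move=> y Sy yw; apply: rP => //; have := ler_distD w y z; lra.
Qed.

Lemma env_le_cont z g : S z -> {for z, continuous g} ->
  (forall y, S y -> f y <= g y) -> usc_env f z <= g z.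
Proof.
move=> Sz cg fg; apply/ler_addgt0Pr => e e0; apply: env_le => //.
near=> y; apply: le_trans (fg _ _) (ltW _); near: y; first exact: withinT.
apply: cvg_within; have /cvgrPdist_lt/(_ _ e0) := cg.
by apply: filterS => y; rewrite ltr_distlC => /andP[_ ?]; lra.
Unshelve. all: by end_near. Qed.

Lemma env_approx z e (P : V -> Prop) : S z -> 0 < e ->
  (\forall y \near within S (nbhs z), P y) ->
  exists y, [/\ S y, P y & usc_env f z - e < f y].
Proof.
move=> Sz e0 Pz; apply: contrapT => H.
have : usc_env f z <= usc_env f z - e; last by lra.
apply: env_le => //; near=> y; rewrite leNgt; apply/negP => ey; apply: H.
exists y; split => //; near: y => //; exact: withinT.
Unshelve. all: by end_near. Qed.

End Envelope.

(** * Barriers and Perron's construction *)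

Section Perron.
Variable u0 : V -> R.
Let S0 := [set z | S z /\ tm z = 0].
Hypothesis S0_neq0 : S0 !=set0.
Hypothesis u0_cont : forall y, S0 y -> forall e : R, 0 < e ->
  \forall x \near within S0 (nbhs y), `|u0 x - u0 y| < e.

Lemma initial_compact : compact S0.
Proof.
have -> : S0 = S `&` (tm @^-1` [set 0]) by [].
apply: compact_closedI => //; apply: closed_comp; last exact: closed_eq.
by move=> x _; exact: tm_cont.
Qed.

Lemma initial_bounded : exists2 M, 0 <= M & forall z, S0 z -> `|u0 z| <= M.
Proof.
have [x Sx xM] : exists2 x, S0 x & forall y, S0 y -> u0 y <= u0 x.
  apply: usc_max => // [|z Sz e e0]; first exact: initial_compact.
  by apply: filterS (u0_cont Sz e0) => w; rewrite ltr_distl => /andP[_].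
have [x' Sx' xM'] : exists2 x, S0 x & forall y, S0 y -> - u0 y <= - u0 x.
  apply: usc_max => // [|z Sz e e0]; first exact: initial_compact.
  by apply: filterS (u0_cont Sz e0) => w; rewrite ltr_distl => /andP[? _]; lra.
exists (Num.max `|u0 x| `|u0 x'|); first by rewrite le_max normr_ge0.
move=> z Sz; rewrite ler_norml; apply/andP; split.
  rewrite lerNl le_max; apply/orP; right.
  by apply: le_trans (xM' _ Sz) _; rewrite ler_normr lexx orbT.
rewrite le_max; apply/orP; left; apply: le_trans (xM _ Sz) _; exact: ler_norm.
Qed.

(** Within distance r of [y] continuity gives the bound [e]; farther away the quadratic term with K
    = 2 M / r^2 exceeds the largest possible oscillation 2 M. *)
Lemma initial_modulus y e : S0 y -> 0 < e ->
  exists K, forall x, S0 x -> `|u0 x - u0 y| <= e + K * q x y.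
Proof.
move=> Sy e0; have [M M0 MP] := initial_bounded.
have /near_withinP[r r0 rP] := u0_cont Sy e0.
exists (2 * M / r ^+ 2) => x Sx; have K0 : 0 <= 2 * M / r ^+ 2.
  by rewrite divr_ge0 ?exprn_ge0 ?mulr_ge0// ltW.
have [xr|rx] := ltP `|x - y| r.
  by apply: le_trans (ltW (rP _ Sx xr)) _; rewrite lerDl mulr_ge0// q_ge0.
have : 2 * M <= 2 * M / r ^+ 2 * q x y.
  rewrite -mulrA ler_peMr// ?mulr_ge0// mulrC ler_pdivlMr ?exprn_gt0// mul1r.
  apply: le_trans (q_ge x y).
  by rewrite lerXn2r ?nnegrE// ltW.
have := ler_normB (u0 x) (u0 y); have := MP _ Sx; have := MP _ Sy; lra.
Qed.

(** [K] comes from the modulus of [u0] at [y], which places the paraboloid below [u0]. The time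
    slope [- M] outweighs the bound of [E] on the compact [S], so the paraboloid is a classical
    subsolution. *)
Lemma lower_barrier y e : S0 y -> 0 < e -> exists b, [/\ C b, subsol b,
  forall x, S0 x -> b x <= u0 x & u0 y - e <= b y].
Proof.
move=> Sy e0; have [K KP] := initial_modulus Sy e0.
have [M MP] := E_quad_bounded (- K) y.
exists (paraboloid (- K) y (- M) (u0 y - e)); split => //.
- apply: C_subsol => // z Sz; rewrite E_quadl//.
  by have := MP z Sz; rewrite ler_norml => /andP[_]; lra.
- move=> x Sx; have [_ tx] := Sx; have := KP x Sx; rewrite /paraboloid tx ler_norml.
  by move=> /andP[? _]; lra.
- by have [_ ty] := Sy; rewrite /paraboloid ty qxx; lra.
Qed.

Lemma upper_barrier y e : S0 y -> 0 < e -> exists b, [/\ C b, supersol b,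
  forall x, S0 x -> u0 x <= b x & b y <= u0 y + e].
Proof.
move=> Sy e0; have [K KP] := initial_modulus Sy e0.
have [M MP] := E_quad_bounded K y.
exists (paraboloid K y M (u0 y + e)); split => //.
- apply: C_supersol => // z Sz; rewrite E_quadl//.
  by have := MP z Sz; rewrite ler_norml => /andP[? _]; lra.
- move=> x Sx; have [_ tx] := Sx; have := KP x Sx; rewrite /paraboloid tx ler_norml.
  by move=> /andP[_ ?]; lra.
- by have [_ ty] := Sy; rewrite /paraboloid ty qxx; lra.
Qed.

(** Passing from the supremum to its envelope does not spoil the initial inequality: upper barriers
    are continuous and dominate all competitors by comparison, hence also the envelope. The envelope
    is therefore itself a competitor, and the largest one. *)
Lemma perron_maximal : exists U, [/\ subsol U, forall x, S0 x -> U x <= u0 x &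
  forall s, subsol s -> (forall x, S0 x -> s x <= u0 x) ->
    forall z, S z -> s z <= U z].
Proof.
have [y0 Sy0] := S0_neq0.
have [bl [Cbl subl bl0 _]] := lower_barrier Sy0 ltr01.
have [bu [Cbu supu bu0 _]] := upper_barrier Sy0 ltr01.
pose P := [set s | subsol s /\ forall x, S0 x -> s x <= u0 x].
have Pbl : P bl by [].
have P_le s b : P s -> supersol b -> (forall x, S0 x -> u0 x <= b x) ->
    forall z, S z -> s z <= b z.
  move=> [ss s0] sb b0; apply: comparison => // z Sz tz.
  by apply: le_trans (s0 _ _) (b0 _ _).
pose u z := sup [set s z | s in P].
have hs z : S z -> has_sup [set s z | s in P].
  move=> Sz; split; first by exists (bl z); exists bl.
  by exists (bu z) => _ [s Ps <-]; exact: P_le.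
have le_u s z : P s -> S z -> s z <= u z.
  by move=> Ps Sz; apply: sup_upper_bound; [exact: hs|exists s].
have u_le b z : supersol b -> (forall x, S0 x -> u0 x <= b x) -> S z -> u z <= b z.
  move=> sb b0 Sz; apply: ge_sup; first by exists (bl z); exists bl.
  by move=> _ [s Ps <-]; exact: P_le.
have [M uM] : exists M, forall z, S z -> `|u z| <= M.
  have [M1 M1P] : exists M, forall z, S z -> bu z <= M.
    by apply: compact_bounded_above; apply: continuous_usc; exact: C_cont.
  have [M2 M2P] : exists M, forall z, S z -> - bl z <= M.
    apply: compact_bounded_above; apply: continuous_usc => z Sz.
    by apply: cvgN; exact: C_cont.
  exists (Num.max M1 M2) => z Sz; rewrite ler_norml le_max lerNl le_max.
  rewrite (le_trans (u_le _ _ supu bu0 Sz) (M1P _ Sz)) andbT.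
  by rewrite (le_trans _ (M2P _ Sz)) ?orbT// lerN2; exact: le_u.
have U0 x : S0 x -> usc_env u x <= u0 x.
  move=> Sx; apply/ler_addgt0Pr => e e0.
  have [b [Cb sb b0 bx]] := upper_barrier Sx e0.
  apply: le_trans bx; case: Sx => Sx tx; apply: env_le_cont => //.
    exact: C_cont.
  by move=> y Sy; exact: u_le.
have usU := env_usc uM.
exists (usc_env u); split => //; last first.
  by move=> s ss s0 z Sz; apply: le_trans (env_ge uM Sz); exact: le_u.
split => // phi Cphi z0 tz0 [Sz0 mz0]; rewrite leNgt; apply/negP => Ez0.
(* Adding the penalty makes the maximum at [z0] strict without changing [E] there. *)
pose psi := phi \+ paraboloid 1 z0 0 0.
have Cpsi : C psi by exact: C_add.
have Epsi : 0 < E psi z0 by rewrite E_quad ?addr0//; right.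
have psiE w : psi w = phi w + q w z0 by rewrite /psi /paraboloid /=; ring.
have /near_withinP[r r0 rP] : \forall w \near within S (nbhs z0),
    (usc_env u w - phi w <= usc_env u z0 - phi z0) /\ 0 < E psi w.
  apply: filterS2 mz0 (E_cont Cpsi Sz0 Epsi) => w mw.
  by rewrite ltr_distl => /andP[? _]; split=> //; lra.
pose rho := Num.min (r / 2) (tm z0 / 2).
have rho0 : 0 < rho by rewrite lt_min !divr_gt0.
have rhor : rho < r by rewrite gt_min; apply/orP; left; lra.
have rhot : rho < tm z0 by rewrite gt_min; apply/orP; right; lra.
move: rho rho0 rhor rhot => rho rho0 rhor rhot.
(* Three losses of [e] occur: from the envelope to the supremum at [z1], from the supremum to one
   competitor [s], and from psi(z0) to psi(z1). Their sum rho^2 forces q(zh, z0) < rho^2, so the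
   maximum point [zh] of s - psi is interior to the ball. *)
pose e := rho ^+ 2 / 3.
have e0 : 0 < e by rewrite divr_gt0 ?exprn_gt0.
have [|z1 [Sz1 [z1r z1psi] uz1]] := @env_approx u z0 e
    (fun y => `|y - z0| < rho /\ `|psi z0 - psi y| < e) Sz0 e0.
  apply: cvg_within; apply: filterI.
    by apply/nbhs_normP; exists rho => //= w; rewrite distrC.
  by have /cvgrPdist_lt/(_ _ e0) := C_cont Cpsi Sz0.
have [s1 [s [ss s0] <-] s1u] := sup_adherent e0 (hs _ Sz1).
rewrite -/(u z1) in s1u.
have cK : compact (S `&` closed_ball z0 rho).
  by apply: compact_closedI => //; exact: closed_ball_closed.
have inK w : (S `&` closed_ball z0 rho) w <-> S w /\ `|w - z0| <= rho.
  by rewrite /= closed_ballE// /closed_ball_ /= distrC.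
have usK : usc_within (S `&` closed_ball z0 rho) (s \+ (fun w => - psi w)).
  apply: usc_withinD; last first.
    by apply: continuous_usc => w [Sw _]; apply: cvgN; exact: (C_cont Cpsi Sw).
  move=> w [Sw _] d d0; have [uss _] := ss.
  by have := uss _ Sw _ d0; rewrite !near_withinE; apply: filterS => y H [/H].
have [|zh /inK[Szh zhr] zhP] := usc_max cK _ usK.
  by exists z1; apply/inK; split => //; exact: ltW.
have zh1 := zhP z1 (proj2 (inK z1) (conj Sz1 (ltW z1r))); rewrite /= in zh1.
have sle : s zh <= usc_env u zh.
  by apply: le_trans (env_ge uM Szh); exact: le_u.
have [mzh Ezh] := rP _ Szh (le_lt_trans zhr rhor).
have zhlt : `|zh - z0| < rho.
  rewrite -(ltr_pXn2r (n := 2)) ?nnegrE ?(ltW rho0)//.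
  have := q_ge zh z0; have := psiE zh; have := psiE z0; rewrite qxx.
  by move: z1psi; rewrite ltr_distl => /andP[]; rewrite /e in uz1 s1u *; lra.
have tzh : 0 < tm zh.
  by have := tm_lip zh z0; rewrite ler_distl => /andP[? _]; lra.
have : E psi zh <= 0; last by lra.
have [_] := ss; apply=> //; split => //.
apply/near_withinP; exists (rho - `|zh - z0|); first by lra.
move=> w Sw wz; apply: zhP; apply/inK; split => //.
by have := ler_distD zh w z0; lra.
Qed.


Lemma supersol_eq u w : (forall z, S z -> u z = w z) -> supersol u -> supersol w.
Proof.
move=> uw [lu su]; split.
  move=> z Sz e e0; have := lu z Sz e e0; rewrite !near_withinE.
  by apply: filterS => y H Sy; rewrite -!uw//; exact: H.
move=> phi Cphi z tz [Sz mz]; apply: su => //; split => //.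
move: mz; rewrite !near_withinE.
by apply: filterS => y H Sy; rewrite !uw//; exact: H.
Qed.

(** On the outer ring the glued function coincides with [U], so the cut at radius r is invisible to
    semicontinuity. A test function touching the glued function also touches [U], or else touches
    [phi] inside the ball, where [phi] is a classical subsolution. *)
Lemma subsol_bump U phi z0 r : subsol U -> C phi -> 0 < r ->
  (forall w, S w -> `|w - z0| < r -> E phi w <= 0) ->
  (forall w, S w -> r / 2 <= `|w - z0| < r -> phi w <= U w) ->
  subsol (fun w => if `|w - z0| < r then Num.max (U w) (phi w) else U w).
Proof.
move=> [uU sU] Cphi r0 Ephi phiU; set Ub := fun w => _.
have leU w : U w <= Ub w by rewrite /Ub; case: ifP => // _; rewrite le_max lexx.
split.
  move=> x Sx e e0; have [xr|rx] := ltP `|x - z0| r.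
    have uphi : usc_within S phi by apply: continuous_usc; exact: C_cont.
    have lephi : phi x <= Ub x by rewrite /Ub xr le_max lexx orbT.
    apply: filterS2 (uU x Sx e e0) (uphi x Sx e e0) => y Uy phiy.
    have := leU x; rewrite {2}/Ub; case: ifP => _; last by lra.
    by rewrite gt_max => Ux; apply/andP; split; lra.
  apply/near_withinP; have /near_withinP[r1 r10 r1P] := uU x Sx e e0.
  (* A point of the ball at distance less than r / 2 from a point outside it lies in the ring. *)
  exists (Num.min r1 (r / 2)); first by rewrite lt_min r10 divr_gt0.
  move=> y Sy; rewrite lt_min => /andP[yr1 yr2].
  have := leU x; have := r1P _ Sy yr1; rewrite {2}/Ub; case: ifP => yr; last by lra.
  have : phi y <= U y.
    by apply: phiU => //; rewrite yr andbT; have := ler_distD y x z0; rewrite (distrC x y); lra.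
  by rewrite gt_max => *; apply/andP; split; lra.
move=> th Cth x tx [Sx mx].
have [Ux|Ux] := eqVneq (Ub x) (U x).
  apply: sU => //; split => //; apply: filterS mx => y; rewrite Ux.
  by have := leU y; lra.
have [xr phix] : `|x - z0| < r /\ Ub x = phi x.
  move: Ux; rewrite /Ub; case: (ltP `|x - z0| r) => [xr|]; last by rewrite eqxx.
  by case: (leP (U x) (phi x)); rewrite ?eqxx.
apply: le_trans (E_max Cth Cphi tx _) (Ephi _ Sx xr); split => //.
move: mx => /near_withinP[r1 r10 r1P]; apply/near_withinP.
exists (Num.min r1 (r - `|x - z0|)); first by rewrite lt_min r10; lra.
move=> y Sy; rewrite lt_min => /andP[yr1 yr2]; have := r1P _ Sy yr1.
have yr : `|y - z0| < r by have := ler_distD x y z0; lra.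
have : phi y <= Ub y by rewrite /Ub yr le_max lexx orbT.
by rewrite phix; lra.
Qed.

Lemma perron : exists U, [/\ subsol U, supersol U & forall x, S0 x -> U x = u0 x].
Proof.
have [U [sU U0 Umax]] := perron_maximal.
have [M UM] : exists M, forall z, S z -> `|- U z| <= M.
  have [M1 M1P] : exists M, forall z, S z -> U z <= M.
    by apply: compact_bounded_above; case: sU.
  have [y0 Sy0] := S0_neq0; have [bl [Cbl subl bl0 _]] := lower_barrier Sy0 ltr01.
  have [M2 M2P] : exists M, forall z, S z -> - bl z <= M.
    apply: compact_bounded_above; apply: continuous_usc => z Sz.
    by apply: cvgN; exact: C_cont.
  exists (Num.max M1 M2) => z Sz; rewrite normrN ler_norml le_max lerNl le_max.
  rewrite (M1P _ Sz) andbT.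
  by rewrite (le_trans _ (M2P _ Sz)) ?orbT// lerN2; exact: Umax.
pose L z := - usc_env (fun w => - U w) z.
have LU z : S z -> L z <= U z by move=> Sz; rewrite lerNl; exact: (env_ge UM).
have uL : usc_within S (fun z => - L z).
  have -> : (fun z => - L z) = usc_env (fun w => - U w).
    by apply/funext => z; rewrite opprK.
  exact: (env_usc UM).
have L0 x : S0 x -> u0 x <= L x.
  move=> Sx; apply/ler_addgt0Pr => e e0.
  have [b [Cb sb b0 bx]] := lower_barrier Sx e0.
  rewrite -lerBlDr; apply: le_trans bx _; rewrite lerNr.
  case: Sx => Sx _; apply: (@env_le_cont _ x (fun z => - b z)) => //.
    by apply: cvgN; exact: C_cont.
  by move=> y Sy; rewrite lerN2; exact: Umax.
suff sL : supersol L.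
  have leUL : forall z, S z -> U z <= L z.
    by apply: comparison => // z Sz tz; apply: le_trans (U0 _ _) (L0 _ _).
  have UL z : S z -> L z = U z by move=> Sz; apply/eqP; rewrite eq_le LU// leUL.
  exists U; split => //; first exact: supersol_eq sL.
  by move=> x Sx; apply/eqP; rewrite eq_le U0//= -UL ?L0//; case: Sx.
split => // phi Cphi z0 tz0 [Sz0 mz0]; rewrite leNgt; apply/negP => Ez0.
(* The test function is bent down by the penalty, made to touch [L] at [z0], and then raised by [d].
   The constant leaves [E] unchanged, so one ball with E < 0 serves every [d]. *)
pose psi d := phi \+ paraboloid (- 1) z0 0 (L z0 - phi z0 + d).
have psiE d w : psi d w = phi w - q w z0 + (L z0 - phi z0 + d).
  by rewrite /psi /paraboloid /=; ring.
have Cpsi d : C (psi d) by exact: C_add.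
have Epsi d w : S w -> E (psi d) w = E (psi 0) w.
  move=> Sw; rewrite -[RHS]addr0 -(@E_quad _ 0 z0 0 d) //; last by left.
  by congr (E _ w); apply/funext => y; rewrite /psi /paraboloid /=; ring.
have Epsi0 : E (psi 0) z0 < 0 by rewrite E_quad ?addr0//; right.
have /near_withinP[r1 r10 r1P] : \forall w \near within S (nbhs z0),
    (L z0 - phi z0 <= L w - phi w) /\ E (psi 0) w < 0.
  have e0 : 0 < - E (psi 0) z0 by rewrite oppr_gt0.
  apply: filterS2 mz0 (E_cont (Cpsi 0) Sz0 e0) => w mw.
  by rewrite ltr_distl => /andP[_ ?]; split=> //; lra.
(* With r at most [tm z0], initial points lie outside the ball and the bump respects the initial
   inequality. *)
pose r := Num.min r1 (tm z0).
have r0 : 0 < r by rewrite lt_min r10.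
(* On the ring the penalty is at least r^2 / 4 > d, so the raised function stays below [L], hence
   below [U]. *)
pose d := r ^+ 2 / 8.
have d0 : 0 < d by rewrite divr_gt0 ?exprn_gt0.
have rr1 w : `|w - z0| < r -> `|w - z0| < r1 by rewrite lt_min => /andP[].
have Usub : subsol (fun w => if `|w - z0| < r then Num.max (U w) (psi d w) else U w).
  apply: subsol_bump => //.
    by move=> w Sw /rr1 wr; rewrite Epsi//; case: (r1P _ Sw wr) => _ /ltW.
  move=> w Sw /andP[rw /rr1 wr]; have [Lw _] := r1P _ Sw wr.
  have := q_ge w z0; have := LU _ Sw; have : (r / 2) ^+ 2 <= `|w - z0| ^+ 2.
    by rewrite lerXn2r ?nnegrE// ltW// divr_gt0.
  by have := exprn_ge0 2 (ltW r0); rewrite psiE /d; lra.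
have Ub z : S z -> `|z - z0| < r -> psi d z <= U z.
  move=> Sz zr; have := Umax _ Usub _ z Sz; rewrite zr ge_max.
  move=> H; apply: (proj2 (andP (H _))) => x Sx; case: ifP => [xr|_]; last exact: U0.
  have [Sx' tx] := Sx; have := tm_lip x z0; rewrite tx sub0r normrN.
  by move: xr; rewrite lt_min ger0_norm ?tm_ge0// => /andP[_ ?]; lra.
have d30 : 0 < d / 3 by rewrite divr_gt0.
have [|z1 [Sz1 [z1r z1psi] Uz1]] := @env_approx (fun w => - U w) z0 (d / 3)
    (fun y => `|y - z0| < r /\ `|psi d z0 - psi d y| < d / 3) Sz0 d30.
  apply: cvg_within; apply: filterI.
    by apply/nbhs_normP; exists r => //= w; rewrite distrC.
  by have /cvgrPdist_lt/(_ _ d30) := C_cont (Cpsi d) Sz0.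
have := Ub _ Sz1 z1r; move: z1psi; rewrite ltr_distl => /andP[_].
by rewrite (psiE d z0) qxx; rewrite /L in Uz1 *; lra.
Qed.

End Perron.

End Viscosity.

(** * Differential calculus *)

Section Differentials.
Context (R : realType) (V W : normedModType R).
Implicit Types (f : V -> W) (a v : V).

Lemma diff_near f a : differentiable f a -> forall e : R, 0 < e ->
  exists2 r : R, 0 < r &
    forall h, `|h| < r -> `|f (a + h) - f a - 'd f a h| <= e * `|h|.
Proof.
move=> /diff_locally/eqaddoP df e e0.
have /nbhs_normP[r /= r0 rP] := df _ e0.
exists r => // h hr.
have := rP h; rewrite /ball_/= sub0r normrN => /(_ hr).
rewrite !fctE /= [h + a]addrC opprD addrA; exact.
Qed.

Lemma derive_line f a v (c : R) d : is_derive (a + c *: v) v f d ->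
  is_derive c (1 : R) (fun s : R => f (a + s *: v)) d.
Proof.
have E : (fun h : R => h^-1 *: ((fun s : R => f (a + s *: v)) (h *: (1 : R) + c) -
    (fun s : R => f (a + s *: v)) c)) =
  (fun h : R => h^-1 *: (f (h *: v + (a + c *: v)) - f (a + c *: v))).
  apply/funext => h; congr (_ *: (f _ - _)).
  by rewrite scalerDl [h *: (1:R)]mulr1 addrCA.
move=> [df <-]; split; first by rewrite /derivable /= E.
by rewrite /derive /= E.
Qed.

Lemma is_derive_curve (f : V -> W) (c : R -> V) (t : R) v :
  is_derive t (1 : R) c v -> differentiable f (c t) ->
  is_derive t (1 : R) (f \o c) ('d f (c t) v).
Proof.
move=> [dc <-] df; have dc' : differentiable c t by exact/derivable1_diffP.
have dfc : differentiable (f \o c) t by exact: differentiable_comp.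
split; first exact/derivable1_diffP.
by rewrite [LHS]deriveE// [in RHS]deriveE// diff_comp.
Qed.

End Differentials.

Section MatrixNorm.
Context (R : realType).

Lemma coord_le_norm m n (x : 'M[R]_(m, n)) i j : `|x i j| <= `|x|.
Proof.
rewrite [leRHS]/Num.Def.normr/= mx_normrE.
exact: (le_bigmax _ (fun ij => `|x ij.1 ij.2|) (i, j)).
Qed.

Lemma norm_le_coord m n (x : 'M[R]_(m, n)) M : 0 <= M ->
  (forall i j, `|x i j| <= M) -> `|x| <= M.
Proof.
move=> M0 xM; rewrite [leLHS]/Num.Def.normr/= mx_normrE.
by apply: bigmax_le => // -[i j] _; exact: xM.
Qed.

End MatrixNorm.

(** * Locality and algebra of C^k functions *)

Section Ck_theory.
Context (R : realType).

Lemma near_open (V : topologicalType) (U : set V) (P : V -> Prop) z :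
  open U -> U z -> (forall x, U x -> P x) -> \near z, P z.
Proof. by move=> oU Uz UP; near=> x; apply: UP; near: x; exact: open_nbhs_nbhs.
Unshelve. all: by end_near. Qed.

Lemma near_eq_continuous (V W : topologicalType) (f g : V -> W) x :
  (\near x, f x = g x) -> {for x, continuous f} -> {for x, continuous g}.
Proof.
move=> fg cf; rewrite /prop_for /continuous_at -(nbhs_singleton fg).
by apply: cvg_trans cf; apply: near_eq_cvg; apply: filterS fg.
Qed.

Lemma near_eq_differentiable (V W : normedModType R) (f g : V -> W) x :
  (\near x, f x = g x) -> differentiable f x -> differentiable g x.
Proof.
move=> fg df; have gx := nbhs_singleton fg.
have H : g \o shift x = cst (g x) + 'd f x +o_ 0 id.
  apply/eqaddoP => e e0; have /diff_locally/eqaddoP/(_ _ e0) := df.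
  have fg' : \forall h \near (0 : V), f (h + x) = g (h + x).
    by have := fg; rewrite (near_shift 0 x)/=; apply: filterS => y; rewrite /= subr0.
  by apply: filterS2 fg' => y /= fgy; rewrite !fctE /= fgy gx.
have dgE : 'd g x = 'd f x :> (V -> W)   by apply: (@diff_unique _ V W g ('d f x) x) => //; exact: diff_continuous.
apply/diff_locallyP; rewrite dgE; split => //; exact: diff_continuous.
Qed.

Context (V W : normedModType R).

Lemma Ck_eq k (U : set V) (f g : V -> W) : open U ->
  (forall x, U x -> f x = g x) -> Ck k U f -> Ck k U g.
Proof.
move=> oU; elim: k f g => [|k IHk] f g fg /=.
  move=> cf x Ux; apply: near_eq_continuous (cf x Ux).
  exact: near_open fg.
move=> [df Df]; split.
  by move=> x Ux; apply: near_eq_differentiable (df x Ux); exact: near_open fg.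
move=> w; apply: IHk (Df w) => x Ux.
by apply: near_eq_derive; exact: near_open fg.
Qed.

Lemma Ck_sub k (U U' : set V) (f : V -> W) : U' `<=` U -> Ck k U f -> Ck k U' f.
Proof.
move=> UU'; elim: k f => [|k IHk] f /=; first by move=> cf x /UU'; exact: cf.
by move=> [df Df]; split => [x /UU'|w]; [exact: df|exact: IHk].
Qed.

Lemma C1D (U : set V) (f g : V -> W) : open U ->
  Ck 1 U f -> Ck 1 U g -> Ck 1 U (f \+ g).
Proof.
move=> oU [df Df] [dg Dg]; split => [x Ux|w x Ux].
  by apply: differentiableD; [exact: df|exact: dg].
apply: (@near_eq_continuous _ _ ('D_w f \+ 'D_w g)).
  apply: near_open Ux _ => // y Uy; rewrite -[f \+ g]/(f + g) deriveD//.
  - exact/diff_derivable/df.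
  - exact/diff_derivable/dg.
by apply: continuousD; [exact: Df|exact: Dg].
Qed.

End Ck_theory.

Section Ck_coord.
Context (R : realType) (V : normedModType R).

Lemma Ck_coord n k (U : set V) (f : V -> 'rV[R]_n) i : open U ->
  Ck k U f -> Ck k U (fun x => f x 0 i).
Proof.
move=> oU; elim: k f => [|k IHk] f /=.
  move=> cf x Ux; apply: (@continuous_comp _ _ _ f (fun y : 'rV[R]_n => y 0 i)).
    exact: cf.
  exact: coord_continuous.
move=> [df Df]; split => [x Ux|w].
  apply: (@differentiable_comp _ _ _ _ f (fun y : 'rV[R]_n => y 0 i)).
    exact: df.
  exact: differentiable_coord.
apply: Ck_eq (IHk _ (Df w)) => // x Ux.
rewrite derive_mx ?mxE//.
exact/diff_derivable/df.
Qed.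

End Ck_coord.

Section MeanValue.
Context (R : realType) (V : normedModType R).

Lemma mean_value_le (f : V -> R) (x y : V) (L : R) :
  (forall s : R, 0 <= s <= 1 -> differentiable f (x + s *: (y - x))) ->
  (forall s : R, 0 <= s <= 1 -> `|'d f (x + s *: (y - x)) (y - x)| <= L * `|y - x|) ->
  `|f y - f x| <= L * `|y - x|.
Proof.
move=> df dL; pose g (s : R) := f (x + s *: (y - x)).
have dg (s : R) : 0 <= s <= 1 ->
    is_derive s (1 : R) g ('d f (x + s *: (y - x)) (y - x)).
  move=> s01; apply: derive_line; split; first exact/diff_derivable/df.
  by rewrite deriveE//; exact: df.
have dgi (s : R) : s \in `]0, 1[ ->
    is_derive s (1 : R) g ('d f (x + s *: (y - x)) (y - x)).
  by rewrite in_itv/= => /andP[/ltW ? /ltW ?]; apply: dg; apply/andP.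
have cg : {within `[0, 1], continuous g}.
  by apply: derivable_within_continuous => s; rewrite in_itv/= => /dg[].
have [c0] := MVT_segment ler01 dgi cg.
rewrite in_itv/= => c01; rewrite /g scale0r addr0 scale1r subrKC subr0 mulr1.
by move=> ->; exact: dL.
Qed.

Lemma diff_coord m (f : V -> 'rV[R]_m) x h i : differentiable f x ->
  'd (fun y => f y 0 i) x h = ('d f x h) 0 i.
Proof.
move=> df; rewrite -[LHS]deriveE; last first.
  by apply: (@differentiable_comp _ _ _ _ f (fun y : 'rV[R]_m => y 0 i)) => //; exact: differentiable_coord.
by rewrite -[in RHS]deriveE// derive_mx ?mxE//; exact/diff_derivable.
Qed.

(** The norm of row vectors is the sup norm, so applying the scalar inequality to each coordinate
    loses no constant. *)
Lemma mean_value_rV_le m (f : V -> 'rV[R]_m) (x y : V) (L : R) : 0 <= L ->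
  (forall s : R, 0 <= s <= 1 -> differentiable f (x + s *: (y - x))) ->
  (forall s : R, 0 <= s <= 1 -> `|'d f (x + s *: (y - x)) (y - x)| <= L * `|y - x|) ->
  `|f y - f x| <= L * `|y - x|.
Proof.
move=> L0 df dL; apply: norm_le_coord => [|i0 i]; first exact: mulr_ge0.
rewrite ord1 !mxE; apply: (mean_value_le (f := fun z => f z 0 i)) => s s01.
  apply: (@differentiable_comp _ _ _ _ f (fun y : 'rV[R]_m => y 0 i)).
    exact: df.
  exact: differentiable_coord.
rewrite diff_coord; last exact: df.
by apply: le_trans (coord_le_norm _ _ _) (dL _ s01).
Qed.

Lemma segment_ball (x0 x y : V) (r s : R) : `|x - x0| < r -> `|y - x0| < r ->
  0 <= s <= 1 -> `|x + s *: (y - x) - x0| < r.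
Proof.
move=> xr yr /andP[s0 s1].
have -> : x + s *: (y - x) - x0 = (1 - s) *: (x - x0) + s *: (y - x0).
  have -> : y - x = (y - x0) - (x - x0) by rewrite opprB addrA subrK.
  by rewrite scalerBr scalerBl scale1r addrAC [s *: _ - _]addrC addrA.
apply: le_lt_trans (ler_normD _ _) _; rewrite !normrZ !ger0_norm ?subr_ge0//.
move: xr yr; move: `|x - x0| `|y - x0| => a b ar br.
by have [ab|/ltW ba] := leP a b; nra.
Qed.

End MeanValue.

Section LocalLipschitz.
Context (R : realType) (V : normedModType R) (n : nat).
(** An abstract basis with coordinate functionals of norm at most 1, so that the same lemmas serve
    space ('rV_3) and space-time ('rV_3 * R). *)
Context (e : 'I_n -> V) (c : 'I_n -> V -> R).
Hypothesis ce : forall h, h = \sum_i c i h *: e i.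
Hypothesis c_le : forall i h, `|c i h| <= `|h|.

Definition locally_lipschitz (U : set V) (W : normedModType R) (g : V -> W) x0 :=
  exists L r : R, [/\ 0 <= L, 0 < r, (forall x, `|x - x0| < r -> U x) &
   forall x y, `|x - x0| < r -> `|y - x0| < r -> `|g x - g y| <= L * `|x - y|].

Lemma diff_coords (W : normedModType R) (f : V -> W) x h : differentiable f x ->
  'd f x h = \sum_i c i h *: 'D_(e i) f x.
Proof.
move=> df; rewrite {1}(ce h) linear_sum; apply: eq_bigr => i _.
by rewrite linearZ/= deriveE.
Qed.

Lemma diff_le (f : V -> R) x M h : differentiable f x ->
  (forall i, `|'D_(e i) f x| <= M) -> `|'d f x h| <= M *+ n * `|h|.
Proof.
move=> df fM; rewrite diff_coords//; apply: le_trans (ler_norm_sum _ _ _) _.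
apply: le_trans (_ : \sum_(i < n) M * `|h| <= _).
  by apply: ler_sum => i _; rewrite normrZ mulrC ler_pM.
by rewrite sumr_const card_ord mulrnAl.
Qed.

(** [Ck 1] gives continuity of each directional derivative separately. The finitely many basis
    directions already bound the whole differential near [x0], and the mean value inequality on a
    ball, which is convex, concludes. *)
Lemma C1_lipschitz_real (U : set V) (f : V -> R) x0 : open U -> Ck 1 U f -> U x0 ->
  locally_lipschitz U f x0.
Proof.
move=> oU [df Df] Ux0; pose M := \sum_i (`|'D_(e i) f x0| + 1).
have nM : \forall x \near x0, U x /\ forall i, `|'D_(e i) f x| <= M.
  apply: filterI; first exact: open_nbhs_nbhs.
  apply: filter_forall => i; have /cvgrPdist_lt/(_ _ ltr01) := Df (e i) x0 Ux0.
  apply: filterS => x xM; apply: le_trans (_ : `|'D_(e i) f x0| + 1 <= _).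
    by have := ler_distD 0 ('D_(e i) f x) ('D_(e i) f x0);
      have := ler_distD ('D_(e i) f x0) ('D_(e i) f x) 0; rewrite !subr0 (distrC ('D_(e i) f x)); lra.
  rewrite /M (bigD1 i)//= lerDl; apply: sumr_ge0 => j _.
  by rewrite addr_ge0.
have /nbhs_normP[r /= r0 rP] := nM.
have Ur x : `|x - x0| < r -> U x /\ forall i, `|'D_(e i) f x| <= M.
  by move=> xr; apply: rP; rewrite /= distrC.
have M0 : 0 <= M by apply: sumr_ge0 => i _; rewrite addr_ge0.
exists (M *+ n), r; split => //; first by rewrite mulrn_wge0.
  by move=> x /Ur[].
move=> x y xr yr; rewrite distrC [`|x - y|]distrC.
apply: mean_value_le => s /(segment_ball xr yr)/Ur[Us Ms]; first exact: df.
by apply: diff_le => //; exact: df.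
Qed.

Lemma C1_lipschitz m (U : set V) (f : V -> 'rV[R]_m) x0 : open U -> Ck 1 U f -> U x0 ->
  locally_lipschitz U f x0.
Proof.
move=> oU Cf Ux0.
have /choice[Lr LrP] : forall i : 'I_m, exists Lr : R * R, [/\ 0 <= Lr.1, 0 < Lr.2 &
   forall x y, `|x - x0| < Lr.2 -> `|y - x0| < Lr.2 ->
     `|f x 0 i - f y 0 i| <= Lr.1 * `|x - y|].
  move=> i; have [L [r [L0 r0 _ LP]]] := C1_lipschitz_real oU (Ck_coord i oU Cf) Ux0.
  by exists (L, r).
have /nbhs_normP[r /= r0 rU] : nbhs x0 U by exact: open_nbhs_nbhs.
pose rho := \big[Num.min/r]_i (Lr i).2; pose M := \sum_i (Lr i).1.
have rho_le i : rho <= (Lr i).2 by exact: bigmin_le_cond.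
have M0 : 0 <= M by apply: sumr_ge0 => i _; have [] := LrP i.
exists M, rho; split => //.
- by apply/bigmin_gtP; split => // i _; have [] := LrP i.
- move=> x xr; apply: rU; rewrite /= distrC; apply: lt_le_trans xr _.
  exact: bigmin_le_id.
move=> x y xr yr; apply: norm_le_coord; first exact: mulr_ge0.
move=> i0 i; rewrite ord1 !mxE; have [L0 _ LP] := LrP i.
apply: le_trans (LP _ _ _ _) _; [exact: lt_le_trans xr _|exact: lt_le_trans yr _|].
apply: ler_wpM2r => //; rewrite /M (bigD1 i)//= lerDl.
by apply: sumr_ge0 => j _; have [] := LrP j.
Qed.

(** The Lipschitz property of C^1 maps is taken as a premise so that the lemma covers real-valued as
    well as vector-valued [f]; it is applied to the partial derivatives. *)
Lemma C2_diff_lipschitz (W : normedModType R) (U : set V) (f : V -> W) x0 :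
  (forall g : V -> W, Ck 1 U g -> locally_lipschitz U g x0) ->
  open U -> Ck 2 U f -> U x0 ->
  exists L r : R, [/\ 0 <= L, 0 < r, (forall x, `|x - x0| < r -> U x) &
   forall x y h, `|x - x0| < r -> `|y - x0| < r ->
     `|'d f x h - 'd f y h| <= L * `|x - y| * `|h|].
Proof.
move=> C1L oU [df Df] Ux0.
have /choice[Lr LrP] : forall i : 'I_n, exists Lr : R * R, [/\ 0 <= Lr.1, 0 < Lr.2 &
   forall x y, `|x - x0| < Lr.2 -> `|y - x0| < Lr.2 ->
     `|'D_(e i) f x - 'D_(e i) f y| <= Lr.1 * `|x - y|].
  move=> i; have [L [r [L0 r0 _ LP]]] := C1L _ (Df (e i)).
  by exists (L, r).
have /nbhs_normP[r /= r0 rU] : nbhs x0 U by exact: open_nbhs_nbhs.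
pose rho := \big[Num.min/r]_i (Lr i).2; pose M := \sum_i (Lr i).1.
have rho_le i : rho <= (Lr i).2 by exact: bigmin_le_cond.
have M0 : 0 <= M by apply: sumr_ge0 => i _; have [] := LrP i.
have Urho x : `|x - x0| < rho -> U x.
  by move=> xr; apply: rU; rewrite /= distrC; apply: lt_le_trans xr _; exact: bigmin_le_id.
exists M, rho; split => //.
  by apply/bigmin_gtP; split => // i _; have [] := LrP i.
move=> x y h xr yr; rewrite !diff_coords; [|exact/df/Urho..].
rewrite -sumrB; apply: le_trans (ler_norm_sum _ _ _) _.
rewrite /M !mulr_suml; apply: ler_sum => i _; have [L0 _ LP] := LrP i.
rewrite -scalerBr normrZ mulrC; apply: ler_pM => //.
by apply: LP; [exact: lt_le_trans xr _|exact: lt_le_trans yr _].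
Qed.

End LocalLipschitz.

(** * Curves in level sets *)

(** The intermediate value theorem stands in for the implicit function theorem. Since [W] is in the
    kernel of the differential, f(a + s W + th F) is th D up to an error e |s| D / 2, so it changes
    sign between th = -e |s| and th = e |s|. *)
Lemma level_set_root (R : realType) (V : normedModType R) (U : set V) (f : V -> R)
    (a F W : V) (e : R) :
  open U -> U a -> (forall x, U x -> {for x, continuous f}) ->
  differentiable f a -> f a = 0 -> 0 < 'd f a F -> 'd f a W = 0 -> 0 < e ->
  \forall s \near (0 : R), exists2 th : R, `|th| <= e * `|s| &
    f (a + (s *: W + th *: F)) = 0.
Proof.
move=> oU Ua cf df fa0 D0 W0 e0; set D := 'd f a F in D0.
have /nbhs_normP[r /= r0 rU] : nbhs a U by exact: open_nbhs_nbhs.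
pose N := `|W| + e * `|F| + 1.
have N0 : 0 < N by rewrite ltr_wpDl// addr_ge0// mulr_ge0// ltW.
(* N |s| bounds the displacement s W + th F, so first-order accuracy [eta] makes the error at most
   eta N |s| = e |s| D / 2. *)
pose eta := e * D / (2 * N).
have eta0 : 0 < eta by rewrite divr_gt0 ?mulr_gt0.
have [r1 r10 r1P] := diff_near df eta0.
near=> s.
have sN th : `|th| <= e * `|s| -> `|s *: W + th *: F| <= N * `|s|.
  move=> the; apply: le_trans (ler_normD _ _) _; rewrite !normrZ /N.
  have := normr_ge0 s; have := normr_ge0 F.
  have := ler_wpM2r (normr_ge0 F) the; nra.
have sr : N * `|s| < Num.min r r1.
  rewrite -ltr_pdivlMl//; near: s; apply/nbhs_normP; exists (N^-1 * Num.min r r1) => /=.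
    by rewrite mulr_gt0 ?invr_gt0// lt_min r0.
  by move=> s /=; rewrite sub0r normrN.
move: sr; rewrite lt_min => /andP[sr sr1].
have [s0|s0] := eqVneq s 0.
  by exists 0; rewrite ?normr0 ?mulr_ge0 ?(ltW e0)// s0 !scale0r !addr0.
have s_gt0 : 0 < `|s| by rewrite normr_gt0.
pose g th := f (a + (s *: W + th *: F)).
have gP th : `|th| <= e * `|s| -> `|g th - th * D| <= e * `|s| * D / 2.
  move=> the; have sNth := sN _ the.
  have := r1P (s *: W + th *: F) (le_lt_trans sNth sr1).
  have -> : 'd f a (s *: W + th *: F) = th * D by rewrite linearD !linearZ /= W0 scaler0 add0r.
  rewrite fa0 subr0 => Hle; apply: le_trans Hle _.
  apply: le_trans (ler_wpM2l (ltW eta0) sNth) _.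
  by rewrite /eta le_eqVlt; apply/orP; left; apply/eqP; field; rewrite gt_eqF.
have es0 : 0 <= e * `|s| by rewrite mulr_ge0// ltW.
have cg : {within `[- (e * `|s|), e * `|s|], continuous g}.
  apply: continuous_in_subspaceT => th; rewrite inE /= in_itv/= -ler_norml => the.
  apply: (@continuous_comp _ _ _ (fun th : R => a + (s *: W + th *: F)) f).
    apply: cvgD; first exact: cvg_cst.
    apply: cvgD; first exact: cvg_cst.
    by apply: cvgZr_tmp; exact: cvg_id.
  apply: cf; apply: rU; rewrite /= opprD addrA subrr sub0r normrN.
  exact: le_lt_trans (sN _ the) sr.
have [||th] := @IVT R g (- (e * `|s|)) (e * `|s|) 0 _ cg.
- by lra.
- have gl := gP (- (e * `|s|)); have gr := gP (e * `|s|).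
  rewrite normrN ger0_norm// in gl gr; have {}gl := gl (lexx _); have {}gr := gr (lexx _).
  have esD : 0 < e * `|s| * D by rewrite !mulr_gt0.
  move: gl gr; rewrite !ler_norml => /andP[_ gl] /andP[gr _].
  by rewrite ge_min le_max; apply/andP; split; apply/orP; [left|right]; lra.
- by rewrite in_itv/= -ler_norml => the gth; exists th.
Unshelve. all: by end_near. Qed.

(** Only differentiability at 0 is asked of the curve, so roots may be picked independently for each
    [s] as long as they are o(s). *)
Lemma level_set_curve (R : realType) (V : normedModType R) (U : set V) (f : V -> R)
    (a F W : V) :
  open U -> U a -> (forall x, U x -> {for x, continuous f}) ->
  differentiable f a -> f a = 0 -> 0 < 'd f a F -> 'd f a W = 0 ->
  exists c : R -> V, [/\ c 0 = a, \forall s \near (0 : R), f (c s) = 0 &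
    is_derive (0 : R) (1 : R) c W].
Proof.
move=> oU Ua cf df fa0 D0 W0.
have root e := level_set_root oU Ua cf df fa0 D0 W0 (e := e).
(* The roots need not be unique; choosing [th s] within [s ^+ 2] of the infimum
   of their absolute values is enough for [th s] to be [o(s)]. *)
pose Z (s : R) := [set th : R | f (a + (s *: W + th *: F)) = 0].
have /choice[th thP] : forall s : R, exists th : R, Z s !=set0 ->
    Z s th /\ forall th', Z s th' -> `|th| <= `|th'| + s ^+ 2.
  move=> s; have [s0|s0] := eqVneq s 0.
    exists 0 => _; split; first by rewrite /Z /= s0 !scale0r !addr0.
    by move=> th' _; rewrite normr0 addr_ge0// sqr_ge0.
  have [Zs|nZ] := pselect (Z s !=set0); last by exists 0.
  have s20 : 0 < s ^+ 2 by rewrite exprn_even_gt0.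
  have [|_ [th Zth <-] thlt] := @inf_adherent _ [set `|th| | th in Z s] _ s20.
    split; first by case: Zs => th Zth; exists `|th|, th.
    by exists 0 => _ [th _ <-].
  exists th => _; split => // th' Zth'; apply: le_trans (ltW thlt) _.
  rewrite lerD2r; apply: ge_inf; last by exists th'.
  by exists 0 => _ [th'' _ <-].
pose c s := a + (s *: W + th s *: F).
have th0 : th 0 = 0.
  have Z0 : Z 0 0 by rewrite /Z /= !scale0r !addr0.
  have [_ /(_ _ Z0)] := thP 0 (ex_intro _ _ Z0).
  by rewrite normr0 expr0n/= addr0 normr_le0 => /eqP.
have c0 : c 0 = a by rewrite /c th0 !scale0r !addr0.
exists c; split => //.
  by apply: filterS (root 1 ltr01) => s [t _ Zt]; have [] := thP s (ex_intro _ t Zt).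
have lim : (h^-1 *: (c (h *: (1 : R) + 0) - c 0)) @[h --> (0 : R)^'] --> W.
  apply/cvgrPdist_le => e e0.
  (* The chosen root is at most e' |h| + h^2, hence at most 2 e' |h| once |h| < e'; multiplied by
     |F| this stays below [e]. *)
  pose e' := e / (2 * (`|F| + 1)).
  have F1 : 0 < `|F| + 1 by rewrite ltr_wpDl.
  have e'0 : 0 < e' by rewrite divr_gt0 ?mulr_gt0.
  near=> h.
  have h0 : h != 0 by near: h; exact: nbhs_dnbhs_neq.
  have hlt : `|h| < e'.
    by near: h; exact: dnbhs0_lt.
  have -> : h^-1 *: (c (h *: (1 : R) + 0) - c 0) = W + (h^-1 * th h) *: F.
    rewrite c0 /c addr0 [h *: _]mulr1 addrAC subrr add0r scalerDr !scalerA mulVf//.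
    by rewrite scale1r.
  rewrite opprD addrA subrr sub0r normrN normrZ normrM normrV ?unitfE//.
  have thh : `|th h| <= 2 * e' * `|h|.
    have [t t_le Zt] : exists2 t : R, `|t| <= e' * `|h| & Z h t.
      by near: h; apply: nbhs_dnbhs; exact: root.
    have [_ /(_ _ Zt)] := thP h (ex_intro _ _ Zt).
    rewrite -real_normK ?num_real// expr2; have := normr_ge0 h; nra.
  have h_gt0 : 0 < `|h| by rewrite normr_gt0.
  have hth : `|h|^-1 * `|th h| <= 2 * e' by rewrite ler_pdivrMl// mulrC.
  have : 2 * e' * (`|F| + 1) = e by rewrite /e'; field; rewrite gt_eqF.
  have := normr_ge0 F; have := ler_wpM2r (normr_ge0 F) hth; lra.
split; first by apply/cvg_ex; exists W.
exact/cvg_lim.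
Unshelve. all: by end_near. Qed.

(** * Derivatives along curves, one-sided maxima and derivatives within an interval *)

Section CurveDerivatives.
Context (R : realType).

Lemma is_derive_dist (V : normedModType R) (c : R -> V) (t : R) w :
  is_derive t (1 : R) c w -> forall e : R, 0 < e -> exists2 r : R, 0 < r &
    forall s, `|s - t| < r -> `|c s - c t - (s - t) *: w| <= e * `|s - t|.
Proof.
move=> [/derivable1_diffP dc <-] e e0; have [r r0 rP] := diff_near dc e0.
exists r => // s sr; have := rP _ sr.
by rewrite subrKC deriveE// -linearZ/= [_ *: _]mulr1.
Qed.

(** This transfers a Lipschitz inequality between two curves to their velocities. It serves to bound
    the differential of the flow and, with the roles exchanged, to bound tangent vectors pulled back
    by it. *)
Lemma curve_speed_le (V W : normedModType R) (c : R -> V) (d : R -> W) (t : R) v w C :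
  0 <= C -> is_derive t (1 : R) c v -> is_derive t (1 : R) d w ->
  (\forall s \near t, `|c s - c t| <= C * `|d s - d t|) -> `|v| <= C * `|w|.
Proof.
move=> C0 cv dw /nbhs_normP[r /= r0 rP]; apply/ler_addgt0Pr => e e0.
pose e' := e / (1 + C); have C1 : 0 < 1 + C by rewrite ltr_pwDl.
have e'0 : 0 < e' by rewrite divr_gt0.
have eE : e' * (1 + C) = e by rewrite /e' mulfVK// gt_eqF.
have [r1 r10 r1P] := is_derive_dist cv e'0.
have [r2 r20 r2P] := is_derive_dist dw e'0.
pose h := Num.min r (Num.min r1 r2) / 2.
have h0 : 0 < h by rewrite divr_gt0// !lt_min r0 r10.
have hr : [/\ h < r, h < r1 & h < r2].
  have : Num.min r (Num.min r1 r2) <= r by rewrite ge_min lexx.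
  have : Num.min r (Num.min r1 r2) <= r1 by rewrite !ge_min lexx orbT.
  have : Num.min r (Num.min r1 r2) <= r2 by rewrite !ge_min lexx !orbT.
  by move=> *; split; rewrite /h; rewrite /h in h0; lra.
case: hr => hr hr1 hr2.
have tE : t + h - t = h by rewrite addrAC subrr add0r.
have thE : `|t + h - t| = h by rewrite tE gtr0_norm.
have /= := rP (t + h); rewrite distrC thE => /(_ hr) cd.
have := r1P (t + h); have := r2P (t + h); rewrite thE tE => /(_ hr2) dP /(_ hr1) cP.
have hv : h * `|v| <= `|c (t + h) - c t| + e' * h.
  rewrite -[X in X * _](gtr0_norm h0) -normrZ.
  have := ler_distD (c (t + h) - c t) (h *: v) 0; rewrite !subr0 (distrC (h *: v)); lra.
have hw : `|d (t + h) - d t| <= h * `|w| + e' * h.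
  rewrite -[X in X * `|w|](gtr0_norm h0) -normrZ.
  have := ler_distD (h *: w) (d (t + h) - d t) 0; rewrite !subr0; lra.
rewrite -(ler_pM2l h0) -eE.
have := ler_wpM2l C0 hw; nra.
Qed.

Lemma is_derive_unique (V : normedModType R) (c d : R -> V) (t : R) v w :
  is_derive t (1 : R) c v -> is_derive t (1 : R) d w ->
  (\forall s \near t, c s = d s) -> v = w.
Proof. by move=> [_ <-] [_ <-] cd; exact: near_eq_derive. Qed.

(** Only earlier times are compared, which is what a maximum at the final time provides. *)
Lemma left_max_derive_ge0 (g : R -> R) (t d : R) : is_derive t (1 : R) g d ->
  (\forall s \near t, s <= t -> g s <= g t) -> 0 <= d.
Proof.
move=> gd /nbhs_normP[r /= r0 rP]; rewrite leNgt; apply/negP => d0.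
have [r1 r10 r1P] := is_derive_dist gd (ltac:(by rewrite divr_gt0// oppr_gt0) : 0 < - d / 2).
pose h := Num.min r r1 / 2.
have h0 : 0 < h by rewrite divr_gt0// !lt_min r0 r10.
have [hr hr1] : h < r /\ h < r1.
  have : Num.min r r1 <= r by rewrite ge_min lexx.
  have : Num.min r r1 <= r1 by rewrite !ge_min lexx orbT.
  by move=> *; split; rewrite /h; rewrite /h in h0; lra.
have /= := rP (t - h); rewrite opprB subrKC gtr0_norm// => /(_ hr).
have tE : t - h - t = - h by rewrite addrAC subrr add0r.
have := r1P (t - h); rewrite tE normrN gtr0_norm// => /(_ hr1).
rewrite ler_norml [_ *: _]mulNr => /andP[g1 _] /(_ ltac:(lra)) g2.
by nra.
Qed.

Lemma max_derive_eq0 (g : R -> R) (t d : R) : is_derive t (1 : R) g d ->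
  (\forall s \near t, g s <= g t) -> d = 0.
Proof.
move=> gd gt; apply/eqP; rewrite eq_le; apply/andP; split; last first.
  by apply: left_max_derive_ge0 gd _; apply: filterS gt.
rewrite -oppr_ge0.
have gN : is_derive (- t) (1 : R) (g \o -%R) (- d).
  have [/derivable1_diffP dg dE] := gd.
  have dN : is_derive (- t) (1 : R) (-%R : R -> R) (-1) by apply: is_derive_eq.
  have := is_derive_curve (f := g) dN; rewrite opprK => /(_ dg).
  by rewrite linearN -deriveE// dE.
apply: left_max_derive_ge0 gN _.
have := gt; rewrite -{1}(opprK t) nearN; apply: filterS => s /=; rewrite opprK.
by [].
Qed.

Lemma is_derive_pair (V W : normedModType R) (f : R -> V) (g : R -> W) (t : R) a b :
  is_derive t (1 : R) f a -> is_derive t (1 : R) g b ->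
  is_derive t (1 : R) (fun s => (f s, g s)) (a, b).
Proof.
move=> [/derivable1_diffP df <-] [/derivable1_diffP dg <-].
have dfg := differentiable_pair df dg.
split; first exact/derivable1_diffP.
by rewrite deriveE// diff_pair// !deriveE.
Qed.

Lemma is_derive_line (V W : normedModType R) (f : V -> W) (z h : V) :
  differentiable f z -> is_derive (0 : R) (1 : R) (fun s => f (z + s *: h)) ('d f z h).
Proof.
move=> df; apply: derive_line; rewrite scale0r addr0.
by split; [exact/diff_derivable|rewrite deriveE].
Qed.

Lemma within_derive (V : normedModType R) (g c : R -> V) (T t : R) d :
  0 <= t <= T -> (forall s, 0 <= s <= T -> g s = c s) ->
  is_derive t (1 : R) c d -> is_derive_within `[0, T] g t d.
Proof.
move=> tT gc cd; apply/cvgrPdist_le => e e0; have [r r0 rP] := is_derive_dist cd e0.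
have : \forall s \near t, s != t -> `[0, T]%classic s ->
    `|d - (s - t)^-1 *: (g s - g t)| <= e.
  apply/nbhs_normP; exists r => // s /=; rewrite distrC => sr st; rewrite in_itv/= => sT.
  have st0 : s - t != 0 by rewrite subr_eq0.
  have := rP _ sr; rewrite -!gc// => H.
  rewrite -(ler_pM2l (_ : 0 < `|s - t|)) ?normr_gt0// -normrZ scalerBr scalerA mulfV//.
  by rewrite scale1r distrC mulrC.
by [].
Qed.

Lemma within_derive_unique (V : normedModType R) (g c : R -> V) (T t : R) d d' :
  0 < T -> 0 <= t <= T -> (forall s, 0 <= s <= T -> g s = c s) ->
  is_derive t (1 : R) c d -> is_derive_within `[0, T] g t d' -> d' = d.
Proof.
move=> T0 tT gc cd gd'; have gd := within_derive tT gc cd.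
(* Limits are unique only along a proper filter, so [t] must be an accumulation point of [0, T]: one
   steps to the right if t < T, and to the left otherwise. *)
have PF : ProperFilter (within `[0, T]%classic (t^')).
  apply: Build_ProperFilter_ex => A /nbhs_normP[r /= r0 rA].
  suff [s [st sr sT]] : exists s, [/\ s != t, `|t - s| < r & 0 <= s <= T].
    by exists s; apply: rA => //=; rewrite in_itv.
  have [t0 tT'] := andP tT; have [tlt|tge] := ltP t T.
    pose h := Num.min r (T - t) / 2.
    have h0 : 0 < h by rewrite divr_gt0// lt_min r0 subr_gt0.
    have hr : 2 * h <= r by rewrite /h mulrC divfK// ge_min lexx.
    have hT : 2 * h <= T - t by rewrite /h mulrC divfK// ge_min lexx orbT.
    exists (t + h); split; [by rewrite gt_eqF// ltrDl| |by apply/andP; split; lra].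
    by rewrite opprD addrA subrr sub0r normrN gtr0_norm//; lra.
  pose h := Num.min r T / 2.
  have h0 : 0 < h by rewrite divr_gt0// lt_min r0.
  have hr : 2 * h <= r by rewrite /h mulrC divfK// ge_min lexx.
  have hT : 2 * h <= T by rewrite /h mulrC divfK// ge_min lexx orbT.
  exists (t - h); split; [by rewrite lt_eqF// ltrBlDr ltrDl| |by apply/andP; split; lra].
  by rewrite opprB subrKC gtr0_norm//; lra.
exact: (cvg_unique (@norm_hausdorff _ _) gd' gd).
Qed.

End CurveDerivatives.

(** * Normals and tangent vectors *)

Section Euclidean.
Context (R : realType).
Local Notation V3 := 'rV[R]_3.
Implicit Types x y z n p : 'rV[R]_3.

Lemma dotpC x y : dotp x y = dotp y x.
Proof. by apply: eq_bigr => i _; rewrite mulrC. Qed.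

Lemma dotpDl x y z : dotp (x + y) z = dotp x z + dotp y z.
Proof. by rewrite /dotp -big_split; apply: eq_bigr => i _; rewrite !mxE mulrDl. Qed.

Lemma dotpZl (a : R) x y : dotp (a *: x) y = a * dotp x y.
Proof. by rewrite /dotp mulr_sumr; apply: eq_bigr => i _; rewrite !mxE mulrA. Qed.

Lemma dotpDr x y z : dotp x (y + z) = dotp x y + dotp x z.
Proof. by rewrite dotpC dotpDl !(dotpC _ x). Qed.

Lemma dotpZr (a : R) x y : dotp x (a *: y) = a * dotp x y.
Proof. by rewrite dotpC dotpZl dotpC. Qed.

Lemma dotpNl x y : dotp (- x) y = - dotp x y.
Proof. by rewrite -scaleN1r dotpZl mulN1r. Qed.

Lemma dotpNr x y : dotp x (- y) = - dotp x y.
Proof. by rewrite dotpC dotpNl dotpC. Qed.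

Lemma dotpBl x y z : dotp (x - y) z = dotp x z - dotp y z.
Proof. by rewrite dotpDl dotpNl. Qed.

Lemma dotpBr x y z : dotp x (y - z) = dotp x y - dotp x z.
Proof. by rewrite dotpDr dotpNr. Qed.

Lemma dotp_ge0 x : 0 <= dotp x x.
Proof. by apply: sumr_ge0 => i _; rewrite -expr2 sqr_ge0. Qed.

Lemma dotp_le x y : `|dotp x y| <= 3 * `|x| * `|y|.
Proof.
apply: le_trans (ler_norm_sum _ _ _) _.
apply: le_trans (_ : \sum_(i < 3) `|x| * `|y| <= _).
  by apply: ler_sum => i _; rewrite normrM ler_pM// coord_le_norm.
by rewrite sumr_const card_ord -[leLHS]mulr_natl mulrA.
Qed.

Lemma norm_sqr_le_dotp x : `|x| ^+ 2 <= dotp x x.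
Proof.
have H i : `|x 0 i| <= Num.sqrt (dotp x x).
  rewrite -sqrtr_sqr ler_wsqrtr// /dotp (bigD1 i)//= expr2 lerDl.
  by apply: sumr_ge0 => j _; rewrite -expr2 sqr_ge0.
rewrite -[leRHS]sqr_sqrtr ?dotp_ge0// lerXn2r ?nnegrE ?sqrtr_ge0//.
by apply: norm_le_coord => [|i j]; rewrite ?sqrtr_ge0// ord1.
Qed.

Lemma dotpxx_le x : dotp x x <= 3 * `|x| ^+ 2.
Proof. by have := dotp_le x x; rewrite ger0_norm ?dotp_ge0// -mulrA -expr2. Qed.

Lemma dotpxx_eq0 x : dotp x x = 0 -> x = 0.
Proof.
move=> x0; apply/eqP; rewrite -normr_eq0 -sqrf_eq0 eq_le sqr_ge0 andbT -x0.
exact: norm_sqr_le_dotp.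
Qed.

Lemma norm_le_enorm x : `|x| <= enorm x.
Proof.
rewrite -[leLHS](ger0_norm (normr_ge0 x)) -sqrtr_sqr ler_wsqrtr//.
exact: norm_sqr_le_dotp.
Qed.

Lemma enorm_le x : enorm x <= 2 * `|x|.
Proof.
rewrite -[leRHS]ger0_norm ?mulr_ge0// -sqrtr_sqr ler_wsqrtr//.
by apply: le_trans (dotpxx_le x) _; rewrite exprMn; have := sqr_ge0 `|x|; lra.
Qed.

Lemma enorm1 n : enorm n = 1 -> dotp n n = 1.
Proof. by move=> n1; rewrite -(sqr_sqrtr (dotp_ge0 n)) -/(enorm n) n1 expr1n. Qed.

Lemma enorm1_le n : enorm n = 1 -> `|n| <= 1.
Proof. by move=> <-; exact: norm_le_enorm. Qed.

Lemma tangential_projB n p r :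
  tangential_proj n (p - r) = tangential_proj n p - tangential_proj n r.
Proof. by rewrite /tangential_proj dotpBr scalerBl; rewrite !opprD !opprK addrACA. Qed.

Lemma dotp_tangential_proj n p : enorm n = 1 -> dotp n (tangential_proj n p) = 0.
Proof. by move=> n1; rewrite dotpBr dotpZr (enorm1 n1) mulr1 subrr. Qed.

Lemma norm_tangential_proj n p : enorm n = 1 -> `|tangential_proj n p| <= 4 * `|p|.
Proof.
move=> /enorm1_le n1; apply: le_trans (ler_normB _ _) _; rewrite normrZ.
have := dotp_le n p; have := normr_ge0 n; have := normr_ge0 p.
have := normr_ge0 (dotp n p); move: (`|dotp n p|) => d.
move=> *; have : d <= 3 * `|p| by nra.
nra.
Qed.

(** The projection is itself orthogonal to [n], so it may be taken as [w]; the assumption then says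
    that its square is 0. *)
Lemma tangential_proj_eq0 n p : enorm n = 1 ->
  (forall w, dotp n w = 0 -> dotp p w = 0) -> tangential_proj n p = 0.
Proof.
move=> n1 np; apply: dotpxx_eq0.
have tn := dotp_tangential_proj p n1.
by rewrite {1}/tangential_proj dotpBl dotpZl tn mulr0 subr0; exact: np.
Qed.

(* With t the component of n orthogonal to m, |t|^2 = n.t, so a bound on n.t
   bounds the angle between the two normals. *)
Lemma tangential_proj_lip n m p e : enorm n = 1 -> enorm m = 1 -> 0 <= e ->
  (forall w, dotp m w = 0 -> `|dotp n w| <= e * `|w|) ->
  `|tangential_proj n p - tangential_proj m p| <= 30 * e * `|p|.
Proof.
move=> n1 m1 e0 ne; pose a := dotp m n; pose t := n - a *: m.
have mt : dotp m t = 0 by exact: dotp_tangential_proj.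
have nt : dotp n t = dotp t t.
  by rewrite {2}/t dotpBl dotpZl mt mulr0 subr0.
have te : `|t| <= e.
  have := ne _ mt; rewrite nt ger0_norm ?dotp_ge0// => H.
  have [->|t0] := eqVneq t 0; first by rewrite normr0.
  rewrite -(@ler_pM2r _ `|t|) ?normr_gt0// -expr2.
  exact: le_trans (norm_sqr_le_dotp t) H.
have nE : n = a *: m + t by rewrite /t subrKC.
clearbody t; clearbody a.
have tt1 : a ^+ 2 = 1 - dotp t t.
  have := enorm1 n1; rewrite {1 2}nE dotpDl !dotpDr !dotpZl !dotpZr (dotpC t m) mt (enorm1 m1).
  by lra.
have a1 : `|a| <= 1.
  by rewrite -(expr_le1 (n := 2))// real_normK ?num_real// tt1 gerBl dotp_ge0.
have t1 : `|t| <= 1.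
  rewrite -(expr_le1 (n := 2))//; apply: le_trans (norm_sqr_le_dotp t) _.
  by have := sqr_ge0 a; lra.
(* Substituting n = a m + t, the coefficient 1 - a^2 of (m.p) m equals t.t. Every remaining term
   carries a factor t, and only |a| <= 1 is used, so a near -1 is covered as well. *)
have -> : tangential_proj n p - tangential_proj m p =
    (dotp t t * dotp m p - a * dotp t p) *: m - (a * dotp m p + dotp t p) *: t.
  rewrite /tangential_proj opprB addrC addrA subrK nE dotpDl dotpZl.
  rewrite scalerDr scalerA opprD addrA -scalerBl; congr (_ *: _ - _).
  have -> : dotp t t = 1 - a ^+ 2 by lra.
  by ring.
have mp : `|dotp m p| <= 3 * `|p|.
  have := dotp_le m p; have := enorm1_le m1; have := normr_ge0 p; nra.
have tp : `|dotp t p| <= 3 * e * `|p|.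
  have := dotp_le t p; have := normr_ge0 p; nra.
have tp1 : `|dotp t p| <= 3 * `|p|.
  have := dotp_le t p; have := normr_ge0 p; nra.
have tt : `|dotp t t| <= 3 * e.
  have := dotp_le t t; have := normr_ge0 t; nra.
apply: le_trans (ler_normB _ _) _; rewrite !normrZ.
have c1 : `|dotp t t * dotp m p - a * dotp t p| <= 12 * e * `|p|.
  apply: le_trans (ler_normB _ _) _; rewrite !normrM.
  have h1 : `|dotp t t| * `|dotp m p| <= (3 * e) * (3 * `|p|) by exact: ler_pM.
  have h2 : `|a| * `|dotp t p| <= 1 * (3 * e * `|p|) by exact: ler_pM.
  lra.
have c2 : `|a * dotp m p + dotp t p| <= 6 * `|p|.
  apply: le_trans (ler_normD _ _) _; rewrite normrM.
  have h2 : `|a| * `|dotp m p| <= 1 * (3 * `|p|) by exact: ler_pM.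
  lra.
have h1 := ler_pM (normr_ge0 _) (normr_ge0 _) c1 (enorm1_le m1).
have h2 := ler_pM (normr_ge0 _) (normr_ge0 _) c2 te.
have : 0 <= e * `|p| by rewrite mulr_ge0.
lra.
Qed.

Lemma basis3 (h : V3) : h = \sum_(i < 3) (h 0 i) *: delta_mx 0 i.
Proof. exact: row_sum_delta. Qed.

Definition basis4 (i : 'I_(3 + 1)) : V3 * R :=
  match fintype.split i with inl j => (delta_mx 0 j, 0) | inr _ => (0, 1) end.
Definition coord4 (i : 'I_(3 + 1)) (h : V3 * R) : R :=
  match fintype.split i with inl j => h.1 0 j | inr _ => h.2 end.

Lemma basis4P (h : V3 * R) : h = \sum_i coord4 i h *: basis4 i.
Proof.
have eL (i : 'I_3) : coord4 (lshift 1 i) h *: basis4 (lshift 1 i) = (h.1 0 i *: delta_mx 0 i, 0).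
  rewrite /coord4 /basis4; case: split_ordP => [j /lshift_inj <-|k /eqP].
    by congr pair; exact: mulr0.
  by rewrite eq_lrshift.
have eR (i : 'I_1) : coord4 (rshift 3 i) h *: basis4 (rshift 3 i) = (0, h.2).
  rewrite /coord4 /basis4; case: split_ordP => [j /eqP|k _].
    by rewrite eq_rlshift.
  by congr pair; [exact: scaler0|exact: mulr1].
rewrite big_split_ord big_ord1 eR /=; under eq_bigr do rewrite eL.
rewrite [LHS]surjective_pairing; congr pair => /=.
  rewrite (big_morph fst (id1 := 0) (op1 := +%R)) //= addr0.
  exact: basis3.
rewrite (big_morph snd (id1 := 0) (op1 := +%R)) //= big1 ?add0r//.
Qed.

Lemma coord4_le (i : 'I_(3 + 1)) (h : V3 * R) : `|coord4 i h| <= `|h|.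
Proof.
rewrite /coord4 prod_normE le_max; case: fintype.split => [j|_]; last by rewrite lexx orbT.
by rewrite coord_le_norm.
Qed.

Lemma diff_grad (f : V3 -> R) x h : differentiable f x -> 'd f x h = dotp (grad f x) h.
Proof.
move=> df; rewrite (diff_coords basis3 (W := R^o))//; apply: eq_bigr => i _.
by rewrite mxE mulrC.
Qed.

End Euclidean.

Section Slices.
Context (R : realType) (V W : normedModType R).
Implicit Types (f : V * R -> W) (x h : V) (t : R).

Lemma slice_continuous t : continuous (fun x : V => (x, t)).
Proof.
move=> x; apply: (@differentiable_continuous _ _ _ x (fun y : V => (y, t))).
by apply: differentiable_pair; [exact: ex_diff|exact: differentiable_cst].
Qed.

Lemma slice_open (U : set (V * R)) t : open U -> open [set x | U (x, t)].
Proof.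
move=> oU; have -> : [set x | U (x, t)] = (fun x : V => (x, t)) @^-1` U by [].
by have /continuousP := @slice_continuous t; exact.
Qed.

Lemma slice_derive f t h x : 'D_h (fun y => f (y, t)) x = 'D_(h, 0) f (x, t).
Proof.
rewrite /derive; suff -> : (fun s : R => s^-1 *: (((fun y => f (y, t)) \o shift x) (s *: h) -
    f (x, t))) = (fun s : R => s^-1 *: ((f \o shift (x, t)) (s *: (h, 0)) - f (x, t))) by [].
apply/funext => s; congr (_ *: (f _ - _)); apply: injective_projections => //=.
by rewrite -[s *: 0]/(s * 0) mulr0 add0r.
Qed.

Lemma slice_differentiable f t x :
  differentiable f (x, t) -> differentiable (fun y => f (y, t)) x.
Proof.
by move=> df; apply: (@differentiable_comp _ _ _ _ (fun y : V => (y, t)) f).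
Qed.

Lemma slice_diff f t x h : differentiable f (x, t) ->
  'd (fun y => f (y, t)) x h = 'd f (x, t) (h, 0).
Proof.
move=> df; rewrite -[LHS]deriveE; last exact: slice_differentiable.
by rewrite slice_derive deriveE.
Qed.

Lemma slice_C1 (U : set (V * R)) f t : Ck 1 U f -> Ck 1 [set x | U (x, t)] (fun y => f (y, t)).
Proof.
move=> [df Df]; split => [x Ux|w x Ux].
  by apply: slice_differentiable; exact: df.
have -> : 'D_w (fun y => f (y, t)) = (fun y => 'D_(w, 0) f (y, t)).
  by apply/funext => y; exact: slice_derive.
apply: (@continuous_comp _ _ _ (fun y : V => (y, t)) ('D_(w, 0) f)).
  exact: slice_continuous.
exact: Df.
Qed.

End Slices.

Lemma is_derive_continuous (R : realType) (V : normedModType R) (c : R -> V) (t : R) w :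
  is_derive t (1 : R) c w -> {for t, continuous c}.
Proof. by move=> [/derivable1_diffP dc _]; exact: differentiable_continuous. Qed.

(** * Tangent vectors of level sets and tangential gradients *)

Section Tangent.
Context (R : realType).
Local Notation V3 := 'rV[R]_3.
Implicit Types (G U : set V3) (f k : V3 -> R) (x w n : V3).

Lemma tangent_level G U f x w : open U -> U x -> Ck 1 U f ->
  U `&` G = U `&` [set y | f y = 0] -> G x -> grad f x != 0 ->
  dotp (grad f x) w = 0 -> tangent_vector G x w.
Proof.
move=> oU Ux [df _] UG Gx F0 Fw.
have fx0 : f x = 0.
  have : (U `&` G) x by []. 
  by rewrite UG => -[].
have D0 : 0 < 'd f x (grad f x).
  rewrite diff_grad; last exact: df.
  rewrite lt0r dotp_ge0 andbT; apply: contra_neq F0; exact: dotpxx_eq0.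
have [||c [c0 cf cw]] := level_set_curve oU Ux _ (df _ Ux) fx0 D0 (W := w).
- by move=> y Uy; apply: differentiable_continuous; exact: df.
- by rewrite diff_grad//; exact: df.
exists c; split => //.
have Uc : \forall s \near (0 : R), U (c s).
  apply: (is_derive_continuous cw); rewrite c0.
  exact: open_nbhs_nbhs.
apply: filterS2 cf Uc => s fs Us.
have : (U `&` [set y | f y = 0]) (c s) by [].
by rewrite -UG => -[].
Qed.

Lemma curve_level G U f x w (c : R -> V3) : open U -> U x -> Ck 1 U f ->
  U `&` G = U `&` [set y | f y = 0] -> c 0 = x ->
  (\forall s \near (0 : R), G (c s)) -> is_derive (0 : R) (1 : R) c w ->
  dotp (grad f x) w = 0.
Proof.
move=> oU Ux [df _] UG c0 Gc cw; rewrite -diff_grad; last exact: df.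
have Uc : \forall s \near (0 : R), U (c s).
  apply: (is_derive_continuous cw); rewrite c0.
  exact: open_nbhs_nbhs.
have dfc : differentiable f (c 0) by rewrite c0; exact: df.
have := is_derive_curve cw dfc; rewrite c0 => fcw.
have d0 : is_derive (0 : R) (1 : R) (cst (0 : R)) (0 : R) by exact: is_derive_cst.
apply: (is_derive_unique fcw d0).
apply: filterS2 Gc Uc => s Gs Us /=.
have : (U `&` G) (c s) by [].
by rewrite UG => -[].
Qed.

(** [n] annihilates tangent vectors; for the converse it must be parallel to the gradient F of a
    defining function. The part r = n - b F orthogonal to F is tangent, hence orthogonal to both n
    and F, so r.r = 0. *)
Lemma tangent_of_normal G x n w : smooth_hypersurface G -> G x -> enorm n = 1 ->
  (forall w', tangent_vector G x w' -> dotp n w' = 0) ->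
  dotp n w = 0 -> tangent_vector G x w.
Proof.
move=> hG Gx n1 nT nw; have [U [f [oU Ux fC F0 UG]]] := hG x Gx.
have FC1 : Ck 1 U f by exact: fC.
have {}F0 : grad f x != 0 by exact: F0.
have Tlev v : dotp (grad f x) v = 0 -> tangent_vector G x v by exact: (tangent_level oU Ux FC1 UG Gx F0).
apply: Tlev; set F := grad f x in F0 *.
pose b := dotp F n / dotp F F.
have FF : dotp F F != 0 by apply: contra_neq F0; exact: dotpxx_eq0.
have Fr : dotp F (n - b *: F) = 0 by rewrite dotpBr dotpZr /b mulfVK// subrr.
have nr : dotp n (n - b *: F) = 0 by apply: nT; exact: (tangent_level oU Ux FC1 UG Gx F0).
have nE : n = b *: F.
  by apply/eqP; rewrite -subr_eq0; apply/eqP/dotpxx_eq0; rewrite {1}dotpBl nr dotpZl Fr mulr0 subrr.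
have b0 : b != 0.
  apply/eqP => b0; have := enorm1 n1; rewrite nE b0 scale0r.
  by rewrite -(scale0r 0) dotpZl mul0r => /eqP; rewrite eq_sym oner_eq0.
move: nw; rewrite nE dotpZl => /eqP; rewrite mulf_eq0 (negbTE b0) /=.
by move/eqP.
Qed.

(** Each direction orthogonal to [n] is the velocity of a curve in [G], along which [k] has a
    maximum. Applied to the difference of two functions, this gives equality of tangential gradients
    at a contact point, and independence of the extension when the difference vanishes on [G]. *)
Lemma local_max_grad G x n k : smooth_hypersurface G -> G x -> enorm n = 1 ->
  (forall w, tangent_vector G x w -> dotp n w = 0) -> differentiable k x ->
  (\forall y \near within G (nbhs x), k y <= k x) ->
  tangential_proj n (grad k x) = 0.
Proof.
move=> hG Gx n1 nT dk kx; apply: tangential_proj_eq0 => // w nw.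
have [c [c0 Gc cw]] := tangent_of_normal hG Gx n1 nT nw.
rewrite -diff_grad//.
have dkc : differentiable k (c 0) by rewrite c0.
have := is_derive_curve cw dkc; rewrite c0 => /max_derive_eq0; apply.
have kx' : nbhs x [set y | G y -> k y <= k x] by [].
have := is_derive_continuous cw; rewrite /prop_for /continuous_at c0 => cc.
have kc : nbhs (0 : R) [set s | G (c s) -> k (c s) <= k x] := cc _ kx'.
by apply: filterS2 Gc kc => s Gs /(_ Gs) /=; rewrite c0.
Qed.

End Tangent.

Lemma near_ball (R : realType) (V : normedModType R) (x z : V) (r : R) :
  `|x - z| < r -> nbhs x [set y | `|y - z| < r].
Proof.
move=> xr; apply/nbhs_normP; exists (r - `|x - z|) => /=; first by rewrite subr_gt0.
by move=> y /=; rewrite distrC; have := ler_distD x y z; lra.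
Qed.

Section PairNorm.
Context (R : realType) (U V : normedModType R).
Implicit Types z w : U * V.

Lemma norm_pair_lt z w (r : R) :
  (`|z - w| < r) = (`|z.1 - w.1| < r) && (`|z.2 - w.2| < r).
Proof. by rewrite prod_normE gt_max. Qed.

Lemma norm_pair_le z w : `|z - w| <= `|z.1 - w.1| + `|z.2 - w.2|.
Proof. by rewrite prod_normE ge_max lerDl lerDr !normr_ge0. Qed.

Lemma norm_fst_le z : `|z.1| <= `|z|.
Proof. by rewrite prod_normE le_max lexx. Qed.

Lemma norm_snd_le z : `|z.2| <= `|z|.
Proof. by rewrite prod_normE le_max lexx orbT. Qed.

Lemma differentiable_fst z : differentiable (@fst U V) z.
Proof. by apply: (@linear_differentiable R (U * V)%type U fst) => x; exact: cvg_fst. Qed.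

Lemma differentiable_snd z : differentiable (@snd U V) z.
Proof. by apply: (@linear_differentiable R (U * V)%type V snd) => x; exact: cvg_snd. Qed.

End PairNorm.

(** * Evolving surfaces *)

Section SpaceTimeFunctions.
Context (R : realType).
Local Notation V3 := 'rV[R]_3.

Lemma continuous_row (V : normedModType R) n (F : 'I_n -> V -> R) z :
  (forall j, {for z, continuous (F j)}) -> {for z, continuous (fun w => \row_j F j w)}.
Proof.
move=> cF; apply/cvgrPdist_le => e e0.
have nj : \forall w \near z, forall j, `|F j z - F j w| <= e.
  apply: filter_forall => j.
  by have /cvgrPdist_le/(_ _ e0) := cF j.
apply: filterS nj => w wj; apply: norm_le_coord => [|i j]; first exact: ltW.
by rewrite !mxE.
Qed.

(** The penalty is the Euclidean square because it must be smooth; the sup norm is not. *)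
Definition sqdist (z w : V3 * R) : R :=
  dotp (z.1 - w.1) (z.1 - w.1) + (z.2 - w.2) ^+ 2.

Lemma sqdist_sym z w : sqdist z w = sqdist w z.
Proof.
by rewrite /sqdist -(opprB w.1) dotpNl dotpNr opprK -sqrrN opprB.
Qed.

Lemma sqdist_ge z w : `|z - w| ^+ 2 <= sqdist z w.
Proof.
have h1 := norm_sqr_le_dotp (z.1 - w.1); have h2 := sqr_ge0 (z.2 - w.2).
have h3 := dotp_ge0 (z.1 - w.1).
have -> : `|z - w| = Num.max `|z.1 - w.1| `|z.2 - w.2| by rewrite prod_normE.
rewrite /sqdist; case: (leP `|z.1 - w.1| `|z.2 - w.2|) => _; first rewrite real_normK ?num_real//.
- lra.
- lra.
Qed.

Lemma sqdist_le z w : sqdist z w <= 4 * `|z - w| ^+ 2.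
Proof.
have h1 := dotpxx_le (z.1 - w.1).
have h2 : `|z.1 - w.1| ^+ 2 <= `|z - w| ^+ 2.
  by rewrite lerXn2r ?nnegrE//; exact: (norm_fst_le (z - w)).
have h3 : (z.2 - w.2) ^+ 2 <= `|z - w| ^+ 2.
  by rewrite -real_normK ?num_real// lerXn2r ?nnegrE//; exact: (norm_snd_le (z - w)).
by rewrite /sqdist; lra.
Qed.

Lemma differentiable_dotp (V : normedModType R) (f g : V -> V3) z :
  differentiable f z -> differentiable g z ->
  differentiable (fun y => dotp (f y) (g y)) z.
Proof.
move=> df dg.
have -> : (fun y => dotp (f y) (g y)) = \sum_(i < 3) (fun y => f y 0 i * g y 0 i).
  by apply/funext => y; rewrite fct_sumE.
apply: differentiable_sum => i; apply: differentiableM.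
- apply: (@differentiable_comp _ _ _ _ f (fun y : V3 => y 0 i)) => //.
  exact: differentiable_coord.
- apply: (@differentiable_comp _ _ _ _ g (fun y : V3 => y 0 i)) => //.
  exact: differentiable_coord.
Qed.

Lemma sqdist_continuous : continuous (fun p : (V3 * R) * (V3 * R) => sqdist p.1 p.2).
Proof.
move=> p; apply: differentiable_continuous.
have d1 : differentiable (fun p : (V3 * R) * (V3 * R) => p.1.1 - p.2.1) p.
  apply: differentiableB.
    apply: (@differentiable_comp _ _ _ _ fst fst); exact: differentiable_fst.
  apply: (@differentiable_comp _ _ _ _ snd fst).
    exact: differentiable_snd.
  exact: differentiable_fst.
have d2 : differentiable (fun p : (V3 * R) * (V3 * R) => p.1.2 - p.2.2) p.
  apply: differentiableB.
    apply: (@differentiable_comp _ _ _ _ fst snd).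
      exact: differentiable_fst.
    exact: differentiable_snd.
  apply: (@differentiable_comp _ _ _ _ snd snd); exact: differentiable_snd.
apply: differentiableD; first exact: differentiable_dotp.
exact: (differentiableX 1 d2).
Qed.

Local Notation quad := (@paraboloid R (V3 * R)%type snd sqdist).

Lemma quad_differentiable k z0 l c z : differentiable (quad k z0 l c) z.
Proof.
have d1 : differentiable (fun z : V3 * R => z.1 - z0.1) z.
  by apply: differentiableB; [exact: differentiable_fst|exact: differentiable_cst].
have d2 : differentiable (fun z : V3 * R => z.2 - z0.2) z.
  by apply: differentiableB; [exact: differentiable_snd|exact: differentiable_cst].
apply: differentiableD; last exact: differentiable_cst.
apply: differentiableD.
  apply: differentiableM; first exact: differentiable_cst.
  apply: differentiableD; first exact: differentiable_dotp.
  exact: (differentiableX 1 d2).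
by apply: differentiableM; [exact: differentiable_cst|exact: differentiable_snd].
Qed.

(** Along any line the paraboloid is a polynomial of degree 2 in [s], so its differential is the
    coefficient of [s]. *)
Lemma quad_diff k z0 l c z h : 'd (quad k z0 l c) z h =
  k * (2 * dotp (z.1 - z0.1) h.1 + 2 * (z.2 - z0.2) * h.2) + l * h.2.
Proof.
set B := (RHS); pose A := quad k z0 l c z.
pose D := k * (dotp h.1 h.1 + h.2 ^+ 2).
have pd : is_derive (0 : R) (1 : R) (fun s => A + s * B + s ^+ 2 * D) B.
  apply: is_derive_eq; rewrite /GRing.scale /=; ring.
have := is_derive_line h (quad_differentiable k z0 l c z).
have -> : (fun s : R => quad k z0 l c (z + s *: h)) =
    (fun s => A + s * B + s ^+ 2 * D).
  apply/funext => s; rewrite /A /B /D /paraboloid /sqdist.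
  have -> : (z + s *: h).1 - z0.1 = (z.1 - z0.1) + s *: h.1 by rewrite /= addrAC.
  have -> : (z + s *: h).2 = z.2 + s * h.2 by [].
  move: (z.1 - z0.1) => a.
  by rewrite dotpDl !dotpDr !dotpZl !dotpZr (dotpC h.1 a); ring.
move=> cd; apply: (is_derive_unique cd pd).
by near=> s.
Unshelve. all: by end_near. Qed.

Lemma quad_C1 k z0 l c : Ck 1 setT (quad k z0 l c).
Proof.
split => [z _|w z _]; first exact: quad_differentiable.
have -> : 'D_w (quad k z0 l c) = (fun z =>
    k * (2 * dotp (z.1 - z0.1) w.1 + 2 * (z.2 - z0.2) * w.2) + l * w.2).
  apply/funext => y; rewrite -(quad_diff k z0 l c); apply: deriveE.
  exact: quad_differentiable.
have d1 : differentiable (fun z : V3 * R => z.1 - z0.1) z.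
  by apply: differentiableB; [exact: differentiable_fst|exact: differentiable_cst].
have d2 : differentiable (fun z : V3 * R => z.2 - z0.2) z.
  by apply: differentiableB; [exact: differentiable_snd|exact: differentiable_cst].
apply: differentiable_continuous.
apply: differentiableD; last exact: differentiable_cst.
apply: differentiableM; first exact: differentiable_cst.
apply: differentiableD.
  apply: differentiableM; first exact: differentiable_cst.
  by apply: differentiable_dotp => //; exact: differentiable_cst.
apply: differentiableM; last exact: differentiable_cst.
by apply: differentiableM => //; exact: differentiable_cst.
Qed.

Definition space_grad (phi : V3 * R -> R) (z : V3 * R) : V3 :=
  grad (fun x => phi (x, z.2)) z.1.

Lemma space_gradE phi z j : space_grad phi z 0 j = 'D_(delta_mx 0 j, 0) phi z.
Proof. by rewrite mxE slice_derive -surjective_pairing. Qed.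

Lemma space_gradD phi psi z : differentiable phi z -> differentiable psi z ->
  space_grad (phi \+ psi) z = space_grad phi z + space_grad psi z.
Proof.
move=> dphi dpsi; apply/rowP => j; rewrite [RHS]mxE !space_gradE.
by apply: deriveD; exact/diff_derivable.
Qed.

Lemma space_grad_quad k z0 l c z : space_grad (quad k z0 l c) z = (2 * k) *: (z.1 - z0.1).
Proof.
apply/rowP => j; rewrite space_gradE deriveE; last exact: quad_differentiable.
rewrite quad_diff /= !mulr0 !addr0.
have -> : dotp (z.1 - z0.1) (delta_mx 0 j) = (z.1 - z0.1) 0 j.
  rewrite /dotp (bigD1 j)//= big1 => [|i ij]; last by rewrite [delta_mx _ _ _ _]mxE (negbTE ij) andbF mulr0.
  by rewrite [delta_mx _ _ _ _]mxE !eqxx mulr1 addr0.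
by rewrite [RHS]mxE; ring.
Qed.

End SpaceTimeFunctions.

Section EvolvingSurface.
Context (R : realType) (G0 : set 'rV[R]_3) (T : R)
  (Phi : 'rV[R]_3 -> R -> 'rV[R]_3) (v : 'rV[R]_3 * R -> 'rV[R]_3)
  (nu : 'rV[R]_3 -> R -> 'rV[R]_3).
Hypothesis ES : evolving_surface G0 T Phi v nu.
(** [Psi] is a smooth extension of the flow to an open neighbourhood [O] of [G0] times [0, T]; all
    differentials of the flow are taken of [Psi]. *)
Context (Psi : 'rV[R]_3 * R -> 'rV[R]_3) (O : set ('rV[R]_3 * R)).
Hypothesis oO : open O.
Hypothesis GO : forall X t, G0 X -> 0 <= t <= T -> O (X, t).
Hypothesis PsiC : forall k, Ck k O Psi.
Hypothesis PsiE : forall X t, G0 X -> 0 <= t <= T -> Psi (X, t) = Phi X t.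
Local Notation S := (spacetime G0 T Phi).
Local Notation V3 := 'rV[R]_3.
Local Notation quad := (@paraboloid R (V3 * R)%type snd (@sqdist R)).

Lemma Psi_diff z : O z -> differentiable Psi z.
Proof. by have [dPsi _] := PsiC 1%N; exact: dPsi. Qed.

Lemma spacetimeP z : S z -> exists X, [/\ G0 X, 0 <= z.2 <= T & z.1 = Phi X z.2].
Proof. by move=> [tT [X GX <-]]; exists X. Qed.

Lemma spacetime_flow X t : G0 X -> 0 <= t <= T -> S (Phi X t, t).
Proof. by move=> GX tT; split => //; exists X. Qed.

Lemma flow_lipschitz z : O z -> locally_lipschitz O Psi z.
Proof. by move=> Oz; exact: (C1_lipschitz (@basis4P R) (@coord4_le R) oO (PsiC 1%N) Oz). Qed.

Lemma flow_diff_lipschitz z : O z ->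
  exists L r : R, [/\ 0 <= L, 0 < r, (forall x, `|x - z| < r -> O x) &
   forall x y h, `|x - z| < r -> `|y - z| < r ->
     `|'d Psi x h - 'd Psi y h| <= L * `|x - y| * `|h|].
Proof.
move=> Oz; apply: (C2_diff_lipschitz (@basis4P R) (@coord4_le R) _ oO (PsiC 2%N) Oz).
by move=> g Cg; exact: (C1_lipschitz (@basis4P R) (@coord4_le R) oO Cg Oz).
Qed.

Lemma inverse_flow t : 0 <= t <= T -> exists (g : V3 -> V3) (U : set V3),
  [/\ open U, forall X, G0 X -> U (Phi X t), Ck 1 U g &
      forall X, G0 X -> g (Phi X t) = X].
Proof.
move=> tT; have [_ [_ [g [[g' [U [oU sU Cg g'g]]] gK]]]] := es_flow_diffeo ES tT.
exists g', U; split => //.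
- by move=> X GX; apply: sU; exists X.
- by move=> X GX; rewrite g'g ?gK//; exists X.
Qed.

(* The inverse of Phi(., t0) is Lipschitz, and Phi(., t) - Phi(., t0) has a small
   Lipschitz constant for t near t0. *)
Lemma flow_inverse_lipschitz X0 t0 : G0 X0 -> 0 <= t0 <= T ->
  exists C rho : R, [/\ 0 <= C, 0 < rho &
    forall X Y t s, G0 X -> G0 Y -> 0 <= t <= T -> 0 <= s <= T ->
      `|X - X0| < rho -> `|Y - X0| < rho -> `|t - t0| < rho -> `|s - t0| < rho ->
      `|X - Y| <= C * (`|Phi X t - Phi Y s| + `|t - s|)].
Proof.
move=> GX0 t0T; have OX0 := GO GX0 t0T.
have [g [Ug [oUg GUg Cg gK]]] := inverse_flow t0T.
have [Lg [rg [Lg0 rg0 _ gP]]] :=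
  C1_lipschitz (@basis3 R) (fun i h => coord_le_norm h 0 i) oUg Cg (GUg _ GX0).
have [L1 [r1 [L10 r10 _ P1]]] := flow_lipschitz OX0.
have [L2 [r2 [L20 r20 O2 P2]]] := flow_diff_lipschitz OX0.
have L1p : 0 < L1 + 1 by rewrite ltr_wpDl.
have LLp : 0 < 2 * (Lg * L2 + 1) by rewrite mulr_gt0// ltr_wpDl// mulr_ge0.
(* The entry [rg / (L1 + 1)] keeps the images at time t0 where the inverse [g] is Lipschitz. The
   last entry gives Lg L2 rho <= 1/2, so the term L2 rho |X - Y| can be absorbed on the left; this
   doubles [Lg]. *)
pose rho := Num.min (Num.min r1 r2) (Num.min (rg / (L1 + 1)) (1 / (2 * (Lg * L2 + 1)))).
have rho0 : 0 < rho by rewrite !lt_min r10 r20 !divr_gt0.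
have rho1 : rho <= r1 by rewrite !ge_min lexx.
have rho2 : rho <= r2 by rewrite !ge_min lexx orbT.
have rhog : rho * (L1 + 1) <= rg by rewrite -ler_pdivlMr// !ge_min lexx !orbT.
have rhoL : rho * (2 * (Lg * L2 + 1)) <= 1 by rewrite -ler_pdivlMr// !ge_min lexx !orbT.
clearbody rho.
have ball1 Z t : `|Z - X0| < rho -> `|t - t0| < rho -> `|(Z, t) - (X0, t0)| < r1.
  by move=> *; rewrite norm_pair_lt /=; apply/andP; split; exact: lt_le_trans rho1.
have ball2 Z t : `|Z - X0| < rho -> `|t - t0| < rho -> `|(Z, t) - (X0, t0)| < r2.
  by move=> *; rewrite norm_pair_lt /=; apply/andP; split; exact: lt_le_trans rho2.
have t0r : `|t0 - t0| < rho by rewrite subrr normr0.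
have X0r : `|X0 - X0| < rho by rewrite subrr normr0.
exists (2 * Lg * (1 + L1)), rho; split => //.
  by rewrite !mulr_ge0// addr_ge0.
move=> X Y t s GX GY tT sT Xr Yr tr sr.
have gball Z : G0 Z -> `|Z - X0| < rho -> `|Phi Z t0 - Phi X0 t0| < rg.
  move=> GZ Zr; rewrite -!PsiE//.
  have := P1 _ _ (ball1 _ _ Zr t0r) (ball1 _ _ X0r t0r).
  have := norm_pair_le (Z, t0) (X0, t0); rewrite /= subrr normr0 addr0 => h1 h2.
  have := ler_wpM2l L10 h1; have := normr_ge0 (Z - X0); nra.
have XYg : `|X - Y| <= Lg * `|Phi X t0 - Phi Y t0|.
  by have := gP _ _ (gball _ GX Xr) (gball _ GY Yr); rewrite !gK.
pose K Z := Psi (Z, t) - Psi (Z, t0).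
have dK Z : `|Z - X0| < rho -> differentiable K Z.
  move=> Zr; apply: differentiableB; apply: slice_differentiable; apply/Psi_diff/O2.
    exact: ball2.
  exact: ball2.
have KXY : `|K X - K Y| <= L2 * rho * `|X - Y|.
  apply: mean_value_rV_le; first by rewrite mulr_ge0// ltW.
    by move=> a /(segment_ball Yr Xr); exact: dK.
  move=> a /(segment_ball Yr Xr); set Z := Y + _ => Zr.
  have OZt : O (Z, t) by exact/O2/ball2.
  have OZt0 : O (Z, t0) by exact/O2/ball2.
  have -> : 'd K Z (X - Y) = 'd Psi (Z, t) (X - Y, 0) - 'd Psi (Z, t0) (X - Y, 0).
    have e1 := slice_diff (X - Y) (Psi_diff OZt).
    have e2 := slice_diff (X - Y) (Psi_diff OZt0).
    have e3 := congr1 (fun l => l (X - Y)) (diffB (slice_differentiable (Psi_diff OZt))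
      (slice_differentiable (Psi_diff OZt0))).
    exact: (etrans e3 (f_equal2 (fun a b => a - b) e1 e2)).
  apply: le_trans (P2 _ _ _ (ball2 _ _ Zr tr) (ball2 _ _ Zr t0r)) _.
  rewrite !prod_normE /= subrr normr0 normr0.
  have n0 := normr_ge0 (X - Y); have n1 := normr_ge0 (t - t0).
  rewrite [Num.max 0 _]max_r// [Num.max _ 0]max_l//.
  by rewrite ler_wpM2r// ler_wpM2l// ltW.
have KE : K X - K Y = (Phi X t - Phi Y t) - (Phi X t0 - Phi Y t0).
  by rewrite /K !PsiE// !opprB [LHS]addrACA [RHS]addrACA [- _ - _]addrC.
have h1 : `|Phi X t0 - Phi Y t0| <= `|Phi X t - Phi Y t| + L2 * rho * `|X - Y|.
  by have := lerB_dist (Phi X t0 - Phi Y t0) (Phi X t - Phi Y t); rewrite distrC -KE; lra.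
have h2 : `|Phi X t - Phi Y t| <= `|Phi X t - Phi Y s| + L1 * `|t - s|.
  have := ler_distD (Phi Y s) (Phi X t) (Phi Y t).
  have := P1 _ _ (ball1 _ _ Yr sr) (ball1 _ _ Yr tr); rewrite !PsiE//.
  have := norm_pair_le (Y, s) (Y, t); rewrite /= subrr normr0 add0r => h3 h4.
  have := ler_wpM2l L10 h3; rewrite (distrC s t); lra.
have h3 : `|X - Y| <= 2 * Lg * `|Phi X t - Phi Y t|.
  have := ler_wpM2l Lg0 h1; have := normr_ge0 (X - Y).
  have : 2 * Lg * L2 * rho <= 1 by nra.
  nra.
have := ler_wpM2l (mulr_ge0 (ler0n R 2) Lg0) h2.
have := mulr_ge0 Lg0 (normr_ge0 (t - s)); have := mulr_ge0 Lg0 (normr_ge0 (Phi X t - Phi Y s)).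
move=> a0 b0 c0; have := mulr_ge0 L10 a0; have := mulr_ge0 L10 b0; nra.
Qed.

Lemma flow_graph_continuous z : O z -> {for z, continuous (fun z => (Psi z, z.2))}.
Proof.
move=> Oz; apply: differentiable_continuous; apply: differentiable_pair.
  exact: Psi_diff.
exact: differentiable_snd.
Qed.

Lemma flow_graph_compact (K : set (V3 * R)) : K `<=` G0 `*` `[0, T] -> compact K ->
  compact [set (Psi z, z.2) | z in K].
Proof.
move=> KG cK; apply: continuous_compact => //.
apply: continuous_in_subspaceT => z /set_mem/KG[GX tT].
by apply: flow_graph_continuous; rewrite [z]surjective_pairing; apply: GO.
Qed.

Lemma domain_compact : compact (G0 `*` `[0, T]).
Proof. by have [_ _ cG _] := es_closed ES; apply: compact_setX => //; exact: segment_compact. Qed.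

Lemma spacetime_compact : compact S.
Proof.
have -> : S = [set (Psi z, z.2) | z in G0 `*` `[0, T]].
  apply/seteqP; split => [[x t] [/= tT [X GX <-]]|_ [[X t] [/= GX tT] <-]].
    by exists (X, t) => //=; rewrite PsiE.
  by rewrite /= in_itv /= in tT; rewrite PsiE//; exact: spacetime_flow.
by apply: flow_graph_compact => //; exact: domain_compact.
Qed.

(** This is continuity of the inverse of the space-time flow, where the inverses at different times
    are not known to be related. The part of the domain far from [X0] is compact, so its image is
    closed, and injectivity at time t0 keeps the base point out of it. *)
Lemma preimage_near X0 t0 rho : G0 X0 -> 0 <= t0 <= T -> 0 < rho ->
  exists2 r : R, 0 < r & forall X t, G0 X -> 0 <= t <= T ->
    `|(Phi X t, t) - (Phi X0 t0, t0)| < r -> `|X - X0| < rho.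
Proof.
move=> GX0 t0T rho0.
pose K := (G0 `*` `[0, T]) `&` [set z : V3 * R | rho <= `|z.1 - X0|].
have cK : compact K.
  apply: compact_closedI; first exact: domain_compact.
  apply: (@closed_comp _ _ (fun z : V3 * R => `|z.1 - X0|) [set y | rho <= y]).
    move=> z _; apply: (@continuous_comp _ _ _ (fun z : V3 * R => z.1 - X0) Num.norm).
      by apply: cvgB; [exact: cvg_fst|exact: cvg_cst].
    exact: norm_continuous.
  exact: closed_ge.
have KG : K `<=` G0 `*` `[0, T] by move=> z [].
have oC : open (~` [set (Psi z, z.2) | z in K]).
  apply: closed_openC; apply: compact_closed; first exact: norm_hausdorff.
  exact: flow_graph_compact.
have z0C : (~` [set (Psi z, z.2) | z in K]) (Phi X0 t0, t0).
  move=> [[X t] [[/= GX tT] rX] [PE tE]]; move: rX.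
  rewrite /= in_itv /= in tT; rewrite PsiE// in PE; rewrite tE in PE.
  have [_ [_ [g [_ gK]]]] := es_flow_diffeo ES t0T.
  have -> : X = X0 by rewrite -(gK _ GX) -(gK _ GX0) PE.
  by rewrite subrr normr0 leNgt rho0.
have /nbhs_normP[r /= r0 rP] : nbhs (Phi X0 t0, t0) (~` [set (Psi z, z.2) | z in K]).
  exact: open_nbhs_nbhs.
exists r => // X t GX tT; rewrite distrC => /rP nK; rewrite ltNge; apply/negP => rX.
apply: nK; exists (X, t) => /=; last by rewrite PsiE.
by split => //; split => //=; rewrite in_itv.
Qed.

Lemma normal_unit z : S z -> enorm (nu z.1 z.2) = 1.
Proof. by move=> [tT Gz]; have [_ /(_ _ Gz)[]] := es_normal ES tT. Qed.

Lemma normal_orth z w : S z -> tangent_vector (surface G0 Phi z.2) z.1 w ->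
  dotp (nu z.1 z.2) w = 0.
Proof. by move=> [tT Gz]; have [_ /(_ _ Gz)[_ nT _]] := es_normal ES tT; exact: nT. Qed.

Lemma tangent_flow X t W : G0 X -> 0 <= t <= T -> tangent_vector G0 X W ->
  tangent_vector (surface G0 Phi t) (Phi X t) ('d Psi (X, t) (W, 0)).
Proof.
move=> GX tT [c [c0 Gc cW]]; exists (fun s => Psi (c s, t)); split.
- by rewrite c0 PsiE.
- by apply: filterS Gc => s Gs; exists (c s) => //; rewrite PsiE.
have dP := Psi_diff (GO GX tT).
have dPc : differentiable (fun y => Psi (y, t)) (c 0).
  by rewrite c0; exact: slice_differentiable.
have := is_derive_curve cW dPc; rewrite c0.
by rewrite (slice_diff W dP).
Qed.

Lemma tangent_flow_surj Y s w : G0 Y -> 0 <= s <= T ->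
  tangent_vector (surface G0 Phi s) (Phi Y s) w ->
  exists2 W, tangent_vector G0 Y W & 'd Psi (Y, s) (W, 0) = w.
Proof.
move=> GY sT [c [c0 Gc cw]]; have [g [U [oU GU [dg _] gK]]] := inverse_flow sT.
have dgc : differentiable g (c 0) by rewrite c0; apply: dg; exact: GU.
have gw := is_derive_curve cw dgc.
have g0 : (g \o c) 0 = Y by rewrite /= c0 gK.
exists ('d g (c 0) w).
  exists (g \o c); split => //.
  by apply: filterS Gc => a [Z GZ cE] /=; rewrite -cE gK.
have dP := Psi_diff (GO GY sT).
have dPc : differentiable (fun y => Psi (y, s)) ((g \o c) 0).
  by rewrite g0; exact: slice_differentiable.
have Pw := is_derive_curve gw dPc; rewrite g0 (slice_diff _ dP) in Pw.
apply: (is_derive_unique Pw cw).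
by apply: filterS Gc => a [Z GZ cE] /=; rewrite -cE gK// PsiE.
Qed.

Lemma Psi_diff_le z L r : (forall x, `|x - z| < r -> O x) ->
  (forall x y, `|x - z| < r -> `|y - z| < r -> `|Psi x - Psi y| <= L * `|x - y|) ->
  0 <= L -> forall x h, `|x - z| < r -> `|'d Psi x h| <= L * `|h|.
Proof.
move=> rO rL L0 x h xr; pose d a : V3 * R := x + a *: h.
have dh : is_derive (0 : R) (1 : R) d h.
  have : is_derive (x + (0 : R) *: h) h id h by exact: is_derive_id.
  by move/derive_line.
have d0 : d 0 = x by rewrite /d scale0r addr0.
have dP : differentiable Psi (d 0) by rewrite d0; exact/Psi_diff/rO.
have := is_derive_curve dh dP; rewrite d0 => Ph.
apply: (curve_speed_le L0 Ph dh); rewrite /= d0.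
have nx := near_ball xr.
have := is_derive_continuous dh; rewrite /prop_for /continuous_at d0 => cd.
have nd : nbhs (0 : R) [set a | `|d a - z| < r] := cd _ nx.
by apply: filterS nd => a ar; exact: rL.
Qed.

(** By [tangential_proj_lip] it is enough to bound nu(z).tau for tau orthogonal to nu(w), so [nu] is
    never differentiated. Such tau is tangent at w, and for any tau' tangent at z one has nu(z).tau
    = nu(z).(tau - tau'); the transport along the flow makes tau - tau' of size |z - w| |tau|. *)
Lemma tangential_proj_normal_lipschitz z0 : S z0 -> exists C r : R, [/\ 0 <= C, 0 < r &
  forall z w p, S z -> S w -> `|z - z0| < r -> `|w - z0| < r ->
    `|tangential_proj (nu z.1 z.2) p - tangential_proj (nu w.1 w.2) p| <=
      C * `|z - w| * `|p|].
Proof.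
move=> Sz0; have [X0 [GX0 t0T z0E]] := spacetimeP Sz0; set t0 := z0.2 in t0T z0E.
have OX0 := GO GX0 t0T.
have [Cb [rho [Cb0 rho0 invP]]] := flow_inverse_lipschitz GX0 t0T.
have [L1 [r1 [L10 r10 O1 P1]]] := flow_lipschitz OX0.
have [L2 [r2 [L20 r20 O2 P2]]] := flow_diff_lipschitz OX0.
have dPsi_le := Psi_diff_le O1 P1 L10.
have [_ hG0 _ _] := es_closed ES.
have [U [f [oU UX0 fC F0 UG]]] := hG0 _ GX0.
have fC1 : Ck 1 U f by exact: fC.
have basis3_le (i : 'I_3) (h : V3) : `|h 0 i| <= `|h| := coord_le_norm h 0 i.
have df x : U x -> differentiable f x by have [df _] := fC1; exact: df.
have [Lf [rf [Lf0 rf0 Uf dfP]]] : exists L r : R, [/\ 0 <= L, 0 < r,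
    (forall x, `|x - X0| < r -> U x) & forall x y h, `|x - X0| < r -> `|y - X0| < r ->
     `|dotp (grad f x) h - dotp (grad f y) h| <= L * `|x - y| * `|h|].
  have C1L (g : V3 -> R) : Ck 1 U g -> locally_lipschitz U g X0.
    by move=> Cg; exact: (C1_lipschitz_real (@basis3 R) basis3_le oU Cg UX0).
  have [L [r [L0 r0 rU LP]]] := C2_diff_lipschitz (@basis3 R) basis3_le C1L oU (fC 2%N) UX0.
  exists L, r; split => // x y h xr yr.
  rewrite -(diff_grad h (df _ (rU _ xr))) -(diff_grad h (df _ (rU _ yr))).
  exact: LP.
set F := grad f X0; have FF : 0 < dotp F F.
  rewrite lt0r dotp_ge0 andbT; apply: contra_neq (F0 X0 (conj UX0 GX0)).
  exact: dotpxx_eq0.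
(* The last entry yields grad f(X).F >= F.F / 2 near [X0], so F stays uniformly transverse to [G0]
   and the correction along F is controlled. *)
pose rr := Num.min (Num.min rho (Num.min r1 r2)) (Num.min rf (dotp F F / (2 * (Lf * `|F| + 1)))).
have LF1 : 0 < 2 * (Lf * `|F| + 1) by rewrite mulr_gt0// ltr_wpDl// mulr_ge0.
have rr0 : 0 < rr by rewrite !lt_min rho0 r10 r20 rf0 divr_gt0.
have rrF : rr * (2 * (Lf * `|F| + 1)) <= dotp F F.
  by rewrite -ler_pdivlMr// !ge_min lexx !orbT.
have [rr_rho rr1 rr2 rrf] : [/\ rr <= rho, rr <= r1, rr <= r2 & rr <= rf].
  by split; rewrite !ge_min lexx ?orbT.
clearbody rr.
have [r r_gt0 rP] := preimage_near GX0 t0T rr0.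
(* The factor 3 is that of [dotp_le]. The first summand compares the differentials of [Psi] at (X,
   t) and (Y, s), the second bounds the push-forward of the correction b F, and the final [Cb]
   bounds |W| by |tau|. *)
pose K := 3 * (L2 * (2 * Cb + 1) + L1 * (Lf * (2 * Cb) * (2 / dotp F F) * `|F|)) * Cb.
have K0 : 0 <= K.
  by rewrite !(mulr_ge0, addr_ge0)// invr_ge0 ltW.
exists (30 * K), (Num.min r rr); split; [by rewrite mulr_ge0|by rewrite lt_min r_gt0|].
move=> z w p Sz Sw; rewrite !lt_min => /andP[zr zrr] /andP[wr wrr].
apply: le_trans (_ : 30 * (K * `|z - w|) * `|p| <= _); last by rewrite !mulrA.
apply: tangential_proj_lip; [exact: normal_unit|exact: normal_unit|exact: mulr_ge0|].
move=> tau ntau.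
have [X [GX tT zE]] := spacetimeP Sz; have [Y [GY sT wE]] := spacetimeP Sw.
have Ttau := tangent_of_normal (es_surface ES sT) (proj2 Sw) (normal_unit Sw)
  (fun _ => @normal_orth _ _ Sw) ntau.
rewrite wE in Ttau; have [W TW Wtau] := tangent_flow_surj GY sT Ttau.
set t := z.2 in tT zE *; set s := w.2 in sT wE Ttau Wtau *.
have Xr : `|X - X0| < rr.
  by apply: (rP _ t GX tT); rewrite -zE -z0E /t /t0 -!surjective_pairing.
have Yr : `|Y - X0| < rr.
  by apply: (rP _ s GY sT); rewrite -wE -z0E /s /t0 -!surjective_pairing.
have tr : `|t - t0| < rr by apply: le_lt_trans zrr; exact: (norm_snd_le (z - z0)).
have sr : `|s - t0| < rr by apply: le_lt_trans wrr; exact: (norm_snd_le (w - z0)).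
have XY : `|X - Y| <= 2 * Cb * `|z - w|.
  have := invP X Y t s GX GY tT sT; rewrite -zE -wE.
  move=> /(_ (lt_le_trans Xr rr_rho) (lt_le_trans Yr rr_rho) (lt_le_trans tr rr_rho)
             (lt_le_trans sr rr_rho)) h.
  have := norm_fst_le (z - w); have := norm_snd_le (z - w) => /= h1 h2.
  apply: le_trans h _; rewrite [2 * Cb]mulrC -mulrA; apply: ler_wpM2l => //.
  by rewrite mulr_natl mulr2n; exact: lerD h2 h1.
have XYts : `|(Y, s) - (X, t)| <= (2 * Cb + 1) * `|z - w|.
  apply: le_trans (norm_pair_le _ _) _; rewrite /= distrC (distrC s).
  by have := norm_snd_le (z - w); rewrite /= -/t -/s; lra.
have Wle : `|W| <= Cb * `|tau|.
  have [c [c0 Gc cW]] := TW.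
  have dPc : differentiable (fun y => Psi (y, s)) (c 0).
    by rewrite c0; exact/slice_differentiable/Psi_diff/GO.
  have cP := is_derive_curve cW dPc.
  rewrite c0 (slice_diff W (Psi_diff (GO GY sT))) Wtau in cP.
  apply: (curve_speed_le Cb0 cW cP); rewrite /= c0.
  have nY := near_ball (lt_le_trans Yr rr_rho).
  have := is_derive_continuous cW; rewrite /prop_for /continuous_at c0 => cc.
  have nc : nbhs (0 : R) [set a | `|c a - X0| < rho] := cc _ nY.
  apply: filterS2 Gc nc => a Ga ar.
  have := invP (c a) Y s s Ga GY sT sT ar; rewrite subrr normr0 addr0 !PsiE//.
  by apply; [exact: lt_le_trans rr_rho|exact: lt_le_trans sr rr_rho..].
have UX : U X by apply/Uf/(lt_le_trans Xr).
have UY : U Y by apply/Uf/(lt_le_trans Yr).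
have dX0f : `|X0 - X0| < rf by rewrite subrr normr0.
have FX : dotp F F / 2 <= dotp (grad f X) F.
  have := dfP _ _ F (lt_le_trans Xr rrf) dX0f.
  rewrite -/F ler_norml => /andP[h _].
  have : Lf * `|X - X0| * `|F| <= Lf * rr * `|F|.
    by rewrite ler_wpM2r// ler_wpM2l// ltW.
  lra.
have FX0 : 0 < dotp (grad f X) F by apply: lt_le_trans FX; rewrite divr_gt0.
have FXW : `|dotp (grad f X) W| <= Lf * `|X - Y| * `|W|.
  have := dfP _ _ W (lt_le_trans Xr rrf) (lt_le_trans Yr rrf).
  have [c [c0 Gc cW]] := TW.
  by rewrite (curve_level oU UY fC1 UG c0 Gc cW) subr0.
(* [W] is tangent to [G0] at [Y]; subtracting b F makes it tangent at [X]. As [W] is orthogonal to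
   grad f(Y), the numerator is only of order |X - Y| |W|. *)
pose b := dotp (grad f X) W / dotp (grad f X) F.
have Fr : dotp (grad f X) (W - b *: F) = 0.
  by rewrite dotpBr dotpZr /b mulfVK ?subrr// gt_eqF.
have gradX : grad f X != 0 by exact: F0.
have TX := tangent_flow GX tT (tangent_level oU UX fC1 UG GX gradX Fr).
rewrite -zE in TX; have := normal_orth Sz TX; rewrite -/t => nX.
have bF : `|b *: F| <= Lf * (2 * Cb) * (2 / dotp F F) * `|F| * Cb * `|z - w| * `|tau|.
  rewrite normrZ /b normrM normfV (gtr0_norm FX0).
  have h1 : (dotp (grad f X) F)^-1 <= 2 / dotp F F.
    by rewrite -[2 / _]invf_div lef_pV2 ?posrE// divr_gt0.
  have h2 : Lf * `|X - Y| * `|W| <= Lf * (2 * Cb * `|z - w|) * (Cb * `|tau|).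
    by apply: ler_pM => //; [exact: mulr_ge0|exact: ler_wpM2l].
  have h3 : `|dotp (grad f X) W| * (dotp (grad f X) F)^-1 <=
      Lf * (2 * Cb * `|z - w|) * (Cb * `|tau|) * (2 / dotp F F).
    by apply: ler_pM => //; [rewrite invr_ge0 ltW|exact: le_trans FXW h2].
  apply: le_trans (ler_wpM2r (normr_ge0 F) h3) _; move: (2 / dotp F F) => D.
  by rewrite le_eqVlt; apply/orP; left; apply/eqP; ring.
have tauE : tau - 'd Psi (X, t) (W - b *: F, 0) =
    (tau - 'd Psi (X, t) (W, 0)) + 'd Psi (X, t) (b *: F, 0).
  have e0 : (W - b *: F, 0) = (W, 0) - (b *: F, 0) :> V3 * R.
    by congr pair; rewrite /= subr0.
  have e := linearB ('d Psi (X, t)) (W, 0) (b *: F, 0); rewrite -e0 in e.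
  have gen (x y z' z'' : V3) : y = z' - z'' -> x - y = (x - z') + z''.
    by move=> ->; rewrite opprB addrA addrAC.
  exact: gen e.
have ballX : `|(X, t) - (X0, t0)| < rr by rewrite norm_pair_lt Xr tr.
have ballY : `|(Y, s) - (X0, t0)| < rr by rewrite norm_pair_lt Yr sr.
have normp (h : V3) : `|(h, 0 : R)| = `|h|.
  by rewrite prod_normE /= normr0 max_l.
have q1 : `|tau - 'd Psi (X, t) (W, 0)| <=
    L2 * ((2 * Cb + 1) * `|z - w|) * (Cb * `|tau|).
  have gen (x y z' : V3) (M : R) : x = y -> `|x - z'| <= M -> `|y - z'| <= M by move=> ->.
  have := gen _ _ _ _ Wtau (P2 _ _ _ (lt_le_trans ballY rr2) (lt_le_trans ballX rr2)).
  move=> /le_trans; apply; rewrite normp; apply: ler_pM => //; first exact: mulr_ge0.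
  exact: ler_wpM2l.
have q2 : `|'d Psi (X, t) (b *: F, 0)| <=
    L1 * (Lf * (2 * Cb) * (2 / dotp F F) * `|F| * Cb * `|z - w| * `|tau|).
  apply: le_trans (dPsi_le _ _ (lt_le_trans ballX rr1)) _.
  by rewrite normp; exact: ler_wpM2l.
have -> : dotp (nu z.1 t) tau = dotp (nu z.1 t) (tau - 'd Psi (X, t) (W - b *: F, 0)).
  by rewrite dotpBr nX subr0.
apply: le_trans (dotp_le _ _) _; rewrite tauE.
have n1 := enorm1_le (normal_unit Sz); rewrite -/t in n1.
set q := _ + _; have : `|q| <= L2 * ((2 * Cb + 1) * `|z - w|) * (Cb * `|tau|) +
    L1 * (Lf * (2 * Cb) * (2 / dotp F F) * `|F| * Cb * `|z - w| * `|tau|).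
  by apply: le_trans (ler_normD _ _) _; exact: lerD.
move=> qle; have nq : 3 * `|nu z.1 t| * `|q| <= 3 * `|q|.
  by rewrite ler_wpM2r// -[leRHS]mulr1 ler_wpM2l.
apply: le_trans nq (le_trans (ler_wpM2l (ler0n _ _) qle) _).
rewrite /K; move: (2 / dotp F F) => D.
by rewrite le_eqVlt; apply/orP; left; apply/eqP; ring.
Qed.

Lemma flow_curve X t : G0 X -> 0 <= t <= T ->
  is_derive t (1 : R) (fun s => Psi (X, s)) ('d Psi (X, t) (0, 1)).
Proof.
move=> GX tT; have dP := Psi_diff (GO GX tT).
have -> : (fun s => Psi (X, s)) = (fun s => Psi ((X, 0) + s *: (0, 1))).
  apply/funext => s; congr Psi; apply: injective_projections => /=.
    by rewrite scaler0 addr0.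
  by rewrite add0r [_ *: _]mulr1.
apply: derive_line.
have -> : (X, 0) + t *: (0, 1) = (X, t) :> V3 * R.
  apply: injective_projections => /=; first by rewrite scaler0 addr0.
  by rewrite add0r [_ *: _]mulr1.
by split; [exact/diff_derivable|rewrite deriveE].
Qed.

(** The velocity is prescribed as a derivative within [0, T], one-sided at the ends; by uniqueness
    it is the two-sided time derivative of the extension [Psi], so the chain rule applies up to the
    end points. *)
Lemma velocityE X t : G0 X -> 0 <= t <= T -> v (Phi X t, t) = 'd Psi (X, t) (0, 1).
Proof.
move=> GX tT; apply: (within_derive_unique (es_time ES) tT _ (flow_curve GX tT) (es_velocity ES GX tT)).
by move=> s sT; rewrite PsiE.
Qed.

Lemma trajectory_curve X t : G0 X -> 0 <= t <= T ->
  is_derive t (1 : R) (fun s => (Psi (X, s), s)) (v (Phi X t, t), 1).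
Proof.
move=> GX tT; rewrite velocityE//; apply: is_derive_pair; exact: flow_curve.
Qed.

Lemma velocity_lipschitz z0 : S z0 -> exists L r : R, [/\ 0 <= L, 0 < r &
  forall z w, S z -> S w -> `|z - z0| < r -> `|w - z0| < r ->
    `|v z - v w| <= L * `|z - w|].
Proof.
move=> Sz0; have [g [U [oU SU Cg gv]]] := es_velocity_C1 ES.
have [L [r [L0 r0 _ LP]]] := C1_lipschitz (@basis4P R) (@coord4_le R) oU Cg (SU _ Sz0).
exists L, r; split => // z w Sz Sw zr wr.
by rewrite -!gv//; exact: LP.
Qed.


(** The operator differentiates the function itself, hence regularity on a neighbourhood is required
    here; a function that is [Ck_on] merely agrees on [S] with one of this class. *)
Definition C1_near (phi : V3 * R -> R) : Prop :=
  exists U, [/\ open U, S `<=` U & Ck 1 U phi].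

Lemma C1_near_quad k z0 l c : C1_near (quad k z0 l c).
Proof. by exists setT; split => //; [exact: openT|exact: quad_C1]. Qed.

Lemma C1_near_add phi psi : C1_near phi -> C1_near psi -> C1_near (phi \+ psi).
Proof.
move=> [U [oU SU Cphi]] [U' [oU' SU' Cpsi]]; exists (U `&` U'); split.
- exact: openI.
- by move=> z Sz; split; [exact: SU|exact: SU'].
- apply: C1D; first exact: openI.
    by apply: Ck_sub Cphi => z [].
  by apply: Ck_sub Cpsi => z [].
Qed.

Lemma C1_near_diff phi z : C1_near phi -> S z -> differentiable phi z.
Proof. by move=> [U [_ SU [dphi _]]] Sz; apply: dphi; exact: SU. Qed.

(** * The Hamilton-Jacobi operator: ellipticity, continuity and the doubling estimate *)

Context (H : V3 * R -> V3 -> R) (L1 L2 : R).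
Hypothesis L1_gt0 : 0 < L1.
Hypothesis L2_gt0 : 0 < L2.
Hypothesis HC : hamiltonian_conditions S H L1 L2.

(* The material derivative of [phi] is its derivative in the direction [(v, 1)]. *)
Definition hj_operator (phi : V3 * R -> R) (z : V3 * R) : R :=
  'd phi z (v z, 1) + H z (tangential_proj (nu z.1 z.2) (space_grad phi z)).

Lemma hamiltonian_dist z w p r : S z -> S w ->
  `|H z p - H w r| <= 3 * L1 * `|z - w| * (1 + 2 * `|p|) + 2 * L2 * `|p - r|.
Proof.
move=> Sz Sw; have [H1 H2] := HC.
have h1 := H1 _ _ p Sz Sw; have h2 := H2 _ p r Sw.
have h3 := ler_distD (H w p) (H z p) (H w r).
have h4 : enorm (z.1 - w.1) + `|z.2 - w.2| <= 3 * `|z - w|.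
  have := enorm_le (z.1 - w.1); have := norm_fst_le (z - w).
  by have := norm_snd_le (z - w) => /=; lra.
have h5 : L1 * (enorm (z.1 - w.1) + `|z.2 - w.2|) * (1 + enorm p) <=
    L1 * (3 * `|z - w|) * (1 + 2 * `|p|).
  apply: ler_pM.
  - by apply: mulr_ge0; [exact: ltW|rewrite addr_ge0// sqrtr_ge0].
  - by rewrite addr_ge0// sqrtr_ge0.
  - by rewrite ler_pM2l.
  - by rewrite lerD2l; exact: enorm_le.
have h6 := ler_wpM2l (ltW L2_gt0) (enorm_le (p - r)).
lra.
Qed.

Lemma hj_operator_quad phi k z0 l c z : C1_near phi -> S z -> k = 0 \/ z = z0 ->
  hj_operator (phi \+ quad k z0 l c) z = hj_operator phi z + l.
Proof.
move=> Cphi Sz kz; have dphi := C1_near_diff Cphi Sz.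
have dq := quad_differentiable k z0 l c z.
have q0 : space_grad (quad k z0 l c) z = 0.
  rewrite space_grad_quad; case: kz => [->|->]; first by rewrite mulr0 scale0r.
  by rewrite subrr scaler0.
have q1 : 'd (quad k z0 l c) z (v z, 1) = l.
  rewrite quad_diff /=; case: kz => [->|->]; first by ring.
  have d0 : dotp 0 (v z0) = 0 by rewrite -(scale0r 0) dotpZl mul0r.
  by rewrite !subrr d0; ring.
have dE : 'd (phi \+ quad k z0 l c) z (v z, 1) = 'd phi z (v z, 1) + l.
  have e := congr1 (fun f : V3 * R -> R => f (v z, 1)) (diffD dphi dq).
  exact: (etrans e (congr1 (fun a => 'd phi z (v z, 1) + a) q1)).
by rewrite /hj_operator space_gradD// q0 addr0 dE addrAC.
Qed.

(** The two paraboloids have the same spatial gradient p and the same time derivative 2k(t - s), so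
    the latter cancels. What remains is 2k(x - y).(v(w) - v(z)) and a difference of Hamiltonians,
    where |p| <= 2k |z - w| and both [v] and the projection vary by O(|z - w|). *)
Lemma hj_operator_double z0 : S z0 -> exists K r : R, [/\ 0 < K, 0 < r &
  forall (z w : V3 * R) (k l : R), S z -> S w -> `|z - z0| < r -> `|w - z0| < r ->
    0 <= k ->
    hj_operator (quad (- k) z 0 0) w + l - hj_operator (quad k w l 0) z <=
      K * (k * `|z - w| ^+ 2 + `|z - w|)].
Proof.
move=> Sz0; have [Lv [rv [Lv0 rv0 vP]]] := velocity_lipschitz Sz0.
have [Cn [rn [Cn0 rn0 nP]]] := tangential_proj_normal_lipschitz Sz0.
(* 6 Lv comes from the transport term and 4 L2 Cn from the two projections. The Hamiltonian's own
   variation contributes 3 L1 |z - w| (1 + 16 k |z - w|), and 51 = 3 + 48. *)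
exists (6 * Lv + 51 * L1 + 4 * L2 * Cn), (Num.min rv rn); split.
- by have := mulr_ge0 (ltW L2_gt0) Cn0; move: L1_gt0; lra.
- by rewrite lt_min rv0.
move=> z w k l Sz Sw; rewrite !lt_min => /andP[zv zn] /andP[wv wn] k0.
have N0 := normr_ge0 (z - w).
have dzw := norm_fst_le (z - w); rewrite /= in dzw.
set p := (2 * k) *: (z.1 - w.1).
have p1 : space_grad (quad k w l 0) z = p by rewrite space_grad_quad.
have p2 : space_grad (quad (- k) z 0 0) w = p.
  by rewrite space_grad_quad /p -(opprB z.1) scalerN mulrN scaleNr opprK.
have pN : `|p| <= 2 * k * `|z - w|.
  by rewrite normrZ ger0_norm ?mulr_ge0// ler_wpM2l// mulr_ge0.
have dE : 'd (quad (- k) z 0 0) w (v w, 1) + l - 'd (quad k w l 0) z (v z, 1) =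
    2 * k * dotp (z.1 - w.1) (v w - v z).
  have e1 := quad_diff (- k) z 0 0 w (v w, 1).
  have e2 := quad_diff k w l 0 z (v z, 1).
  apply: (etrans (f_equal2 (fun a b : R => a + l - b) e1 e2)).
  by rewrite /= dotpBr -(opprB z.1) dotpNl; ring.
have d1 : 'd (quad (- k) z 0 0) w (v w, 1) + l - 'd (quad k w l 0) z (v z, 1) <=
    6 * Lv * (k * `|z - w| ^+ 2).
  rewrite dE; clear dE; have h1 := ler_norm (dotp (z.1 - w.1) (v w - v z)).
  have h2 := dotp_le (z.1 - w.1) (v w - v z); rewrite [`|v w - _|]distrC in h2.
  have h3 := vP _ _ Sz Sw zv wv.
  have h4 : 3 * `|z.1 - w.1| * `|v z - v w| <= 3 * `|z - w| * (Lv * `|z - w|).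
    by apply: ler_pM => //; rewrite ler_pM2l.
  have h5 := ler_wpM2l (mulr_ge0 (ler0n R 2) k0) (le_trans h1 (le_trans h2 h4)).
  by apply: le_trans h5 _; rewrite le_eqVlt; apply/orP; left; apply/eqP; ring.
pose P x := tangential_proj (nu x.1 x.2) p.
have d2 : H w (P w) - H z (P z) <= 3 * L1 * `|z - w| * (1 + 16 * (k * `|z - w|)) +
    2 * L2 * (Cn * `|z - w| * (2 * k * `|z - w|)).
  have h1 := ler_norm (H w (P w) - H z (P z)); have h2 := hamiltonian_dist (P w) (P z) Sw Sz.
  rewrite [`|w - z|]distrC in h2.
  have h3 := norm_tangential_proj p (normal_unit Sw); rewrite -/(P w) in h3.
  have h4 := nP _ _ p Sw Sz wn zn; rewrite -/(P w) -/(P z) [`|w - z|]distrC in h4.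
  apply: le_trans h1 (le_trans h2 _); apply: lerD.
    by apply: ler_wpM2l; [rewrite !mulr_ge0// ltW|lra].
  apply: ler_wpM2l; first by rewrite mulr_ge0// ltW.
  by apply: le_trans h4 _; apply: ler_wpM2l => //; exact: mulr_ge0.
have e : hj_operator (quad (- k) z 0 0) w + l - hj_operator (quad k w l 0) z =
   ('d (quad (- k) z 0 0) w (v w, 1) + l - 'd (quad k w l 0) z (v z, 1)) +
   (H w (P w) - H z (P z)).
  have gen (a b x y : R) : (a + x) + l - (b + y) = (a + l - b) + (x - y) by ring.
  by rewrite /hj_operator p1 p2; exact: gen.
rewrite e; apply: le_trans (lerD d1 d2) _; clear dE d1 d2 e.
have kN : 0 <= k * `|z - w| ^+ 2 by rewrite mulr_ge0// sqr_ge0.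
have := mulr_ge0 (ltW L1_gt0) kN; have := mulr_ge0 (ltW L1_gt0) N0.
have := mulr_ge0 Lv0 N0; have := mulr_ge0 (mulr_ge0 (ltW L2_gt0) Cn0) N0.
rewrite expr2; lra.
Qed.

Lemma space_grad_near phi z d : C1_near phi -> S z -> 0 < d ->
  \forall w \near z, `|space_grad phi w - space_grad phi z| < d.
Proof.
move=> [U [oU SU [dphi Dphi]]] Sz d0.
have cD j : {for z, continuous ('D_(delta_mx 0 j, 0) phi)} by exact/Dphi/SU.
have gE : space_grad phi = (fun w => \row_j 'D_(delta_mx 0 j, 0) phi w).
  by apply/funext => w; apply/rowP => j; rewrite space_gradE mxE.
have cs : {for z, continuous (space_grad phi)} by rewrite gE; exact: continuous_row.
have /cvgrPdist_lt/(_ _ d0) := cs.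
by apply: filterS => w; rewrite distrC.
Qed.

Lemma material_part_near phi z e : C1_near phi -> S z -> 0 < e ->
  \forall w \near within S (nbhs z), `|'d phi w (v w, 1) - 'd phi z (v z, 1)| < e.
Proof.
move=> Cphi Sz e0; have [U [oU SU [dphi Dphi]]] := Cphi.
have [g [Ug [oUg SUg Cg gv]]] := es_velocity_C1 ES.
(* Expanding the differential in the basis turns it into a finite sum of products of continuous
   functions, with the extension [g] in place of [v]. *)
pose a w := \sum_i coord4 i (g w, 1) * 'D_(basis4 R i) phi w.
have aE w : S w -> 'd phi w (v w, 1) = a w.
  move=> Sw; rewrite -gv//.
  exact: (diff_coords (@basis4P R) (W := R^o) _ (C1_near_diff Cphi Sw)).
have ca : {for z, continuous a}.
  have cg : {for z, continuous g}.
    by apply: differentiable_continuous; case: Cg => dg _; exact/dg/SUg.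
  rewrite /prop_for /continuous_at /a.
  apply: (cvg_big (op := +%R)) => [|i _]; first exact: add_continuous.
  apply: cvgM; last exact/Dphi/SU.
  rewrite /coord4; case: fintype.split => [j|_]; last exact: cvg_cst.
  apply: (@continuous_comp _ _ _ g (fun y : V3 => y 0 j)) => //.
  exact: coord_continuous.
have gen (x y x' y' : R) : x = x' -> y = y' -> `|y' - x'| < e -> `|x - y| < e.
  by move=> -> ->; rewrite distrC.
rewrite near_withinE; have /cvgrPdist_lt/(_ _ e0) := ca.
by apply: filterS => w wa Sw; exact: (gen _ _ _ _ (aE w Sw) (aE z Sz) wa).
Qed.

Lemma hj_operator_near phi z e : C1_near phi -> S z -> 0 < e ->
  \forall w \near within S (nbhs z), `|hj_operator phi w - hj_operator phi z| < e.
Proof.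
move=> Cphi Sz e0; set s := space_grad phi z.
have [Cn [rn [Cn0 rn0 nP]]] := tangential_proj_normal_lipschitz Sz.
(* [M] collects all factors of |w - z|, which then contribute at most e / 4. Below, d = e / (32 L2)
   makes the gradient error 2 L2 (4 d) another e / 4; the material part takes the remaining e /
   2. *)
pose M := 3 * L1 * (1 + 8 * `|s|) + 2 * L2 * (Cn * `|s|) + 1.
have M0 : 0 < M.
  have := mulr_ge0 (ltW L1_gt0) (normr_ge0 s).
  have := mulr_ge0 (ltW L2_gt0) (mulr_ge0 Cn0 (normr_ge0 s)).
  by rewrite /M; move: L1_gt0; lra.
pose d := e / (32 * L2).
have d0 : 0 < d by rewrite divr_gt0// mulr_gt0.
have dE : 32 * L2 * d = e by rewrite /d mulrC divfK// gt_eqF// mulr_gt0.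
have e20 : 0 < e / 2 by rewrite divr_gt0.
have n1 := material_part_near Cphi Sz e20.
have n2 := space_grad_near Cphi Sz d0.
have n3 : \forall w \near within S (nbhs z), S w /\ `|w - z| < Num.min rn (e / (4 * M)).
  apply/near_withinP; exists (Num.min rn (e / (4 * M))) => //.
  by rewrite lt_min rn0 divr_gt0// mulr_gt0.
have {}n2 : \forall w \near within S (nbhs z), `|space_grad phi w - s| < d.
  by rewrite near_withinE; apply: filterS n2.
apply: filterS3 n1 n2 n3 => w w1 w2 [Sw wr].
set pz := tangential_proj (nu z.1 z.2) s.
set sw := space_grad phi w in w2 *.
set pw := tangential_proj (nu w.1 w.2) sw.
suff hHe : `|H w pw - H z pz| <= e / 2.
  have gen (x y x' y' : R) : `|x - y| < e / 2 -> `|x' - y'| <= e / 2 ->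
      `|(x + x') - (y + y')| < e.
    move=> h1 h2; have -> : x + x' - (y + y') = (x - y) + (x' - y') by ring.
    by apply: le_lt_trans (ler_normD _ _) _; lra.
  exact: (gen _ _ _ _ w1 hHe).
clear w1; clearbody s sw; move: wr; rewrite lt_min => /andP[wr]; rewrite ltr_pdivlMr ?mulr_gt0// => wM.
have hH := hamiltonian_dist pz pw Sz Sw.
have pzN : `|pz| <= 4 * `|s| by exact: (norm_tangential_proj _ (normal_unit Sz)).
have pzw : `|pz - pw| <= Cn * `|w - z| * `|s| + 4 * d.
  apply: le_trans (ler_distD (tangential_proj (nu w.1 w.2) s) _ _) _; apply: lerD.
    rewrite (distrC w z); apply: nP => //; by rewrite subrr normr0.
  rewrite -tangential_projB; apply: le_trans (norm_tangential_proj _ (normal_unit Sw)) _.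
  by apply: ler_wpM2l => //; rewrite distrC; exact: ltW.
rewrite (distrC (H w pw)); apply: le_trans hH _; rewrite (distrC z w).
have a1 : 3 * L1 * `|w - z| * (1 + 2 * `|pz|) <= 3 * L1 * `|w - z| * (1 + 8 * `|s|).
  by apply: ler_wpM2l; [rewrite !mulr_ge0// ltW|lra].
have a2 : 2 * L2 * `|pz - pw| <= 2 * L2 * (Cn * `|w - z| * `|s| + 4 * d).
  by apply: ler_wpM2l => //; rewrite mulr_ge0// ltW.
have a3 : `|w - z| * M <= e / 4 by lra.
have N0 := normr_ge0 (w - z).
rewrite /M in a3; lra.
Qed.

(** On the time slice psi - phi has a maximum, so the tangential gradients agree and the Hamiltonian
    terms cancel. Along the trajectory through [z] it has a maximum from the past, so its material
    derivative is nonnegative. *)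
Lemma hj_operator_max phi psi z : C1_near phi -> C1_near psi -> 0 < z.2 ->
  local_max_on S (fun w => psi w - phi w) z -> hj_operator phi z <= hj_operator psi z.
Proof.
move=> Cphi Cpsi tz0 [Sz mz].
have dphi := C1_near_diff Cphi Sz; have dpsi := C1_near_diff Cpsi Sz.
have [X [GX tT zE]] := spacetimeP Sz; set t := z.2 in tz0 tT zE *.
have zEt : z = (z.1, t) by rewrite [LHS]surjective_pairing.
have dphi' : differentiable phi (z.1, t) by rewrite -zEt.
have dpsi' : differentiable psi (z.1, t) by rewrite -zEt.
have pE : tangential_proj (nu z.1 t) (space_grad psi z) =
    tangential_proj (nu z.1 t) (space_grad phi z).
  apply/eqP; rewrite -subr_eq0 -tangential_projB; apply/eqP.
  have -> : space_grad psi z - space_grad phi z =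
      grad (fun y => psi (y, t) - phi (y, t)) z.1.
    apply/rowP => j; rewrite [LHS]mxE [X in _ + X]mxE !space_gradE [RHS]mxE.
    have d1 : derivable (fun y => psi (y, t)) z.1 (delta_mx 0 j).
      exact/diff_derivable/slice_differentiable.
    have d2 : derivable (fun y => phi (y, t)) z.1 (delta_mx 0 j).
      exact/diff_derivable/slice_differentiable.
    have e1 := deriveB d1 d2.
    have e2 := slice_derive psi t (delta_mx 0 j) z.1.
    have e3 := slice_derive phi t (delta_mx 0 j) z.1.
    rewrite -zEt in e2 e3.
    by rewrite -e2 -e3; exact: (esym e1).
  apply: (local_max_grad (es_surface ES tT) (proj2 Sz) (normal_unit Sz)).
  - by move=> w Tw; exact: normal_orth Sz Tw.
  - by apply: differentiableB; exact: slice_differentiable.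
  have mz' : nbhs (z.1, t) [set w | S w -> psi w - phi w <= psi z - phi z].
    by rewrite near_withinE in mz; rewrite -zEt.
  have nz : nbhs z.1 [set y | S (y, t) -> psi (y, t) - phi (y, t) <= psi z - phi z].
    exact: (@slice_continuous _ _ t z.1 _ mz').
  rewrite near_withinE; apply: filterS nz => y yS Gy; rewrite /= -zEt; apply: yS.
  by split.
have cz := trajectory_curve GX tT; rewrite -zE -zEt in cz.
pose c s := (Psi (X, s), s).
have ct : c t = z by rewrite /c (PsiE GX tT) -zE -zEt.
have dm : differentiable (psi \- phi) (c t) by rewrite ct; exact: differentiableB.
have hm := is_derive_curve cz dm.
have hge : 0 <= 'd (psi \- phi) (c t) (v z, 1).
  (* For s <= t close to t > 0 the trajectory remains in [S], even when t = T. *)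
  apply: left_max_derive_ge0 hm _.
  have cc : nbhs t [set s | S (c s) -> psi (c s) - phi (c s) <= psi z - phi z].
    have := is_derive_continuous cz; rewrite /prop_for /continuous_at -/(c t) ct => cc.
    by rewrite near_withinE in mz; exact: (cc _ mz).
  have pos : \forall s \near t, 0 < s by exact: lt_nbhsr.
  have tE : psi (c t) - phi (c t) = psi z - phi z by rewrite ct.
  apply: filterS2 cc pos => s sS s0 st.
  have sT : 0 <= s <= T by rewrite (ltW s0) (le_trans st (proj2 (andP tT))).
  have Sc : S (c s) by rewrite /c (PsiE GX sT); exact: spacetime_flow.
  have h := sS Sc; rewrite -tE in h.
  by rewrite /= -/(c s) -/(c t); exact: h.
rewrite ct in hge.
have dE := congr1 (fun f : V3 * R -> R => f (v z, 1)) (diffB dpsi dphi).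
have {}hge : 0 <= 'd psi z (v z, 1) - 'd phi z (v z, 1).
  exact: (le_trans hge (eq_ind_r (fun a => a <= _) (lexx _) dE)).
rewrite /hj_operator -/t pE lerD2r -subr_ge0; exact: hge.
Qed.

(** * Derivatives of a test function in terms of its extension *)

Section TestFunctions.
Context (phi tphi : V3 * R -> R).
Hypothesis Ctphi : C1_near tphi.
Hypothesis tphiE : forall z, S z -> tphi z = phi z.

(** The relation has exactly one value: injectivity of the flow at the given time singles out the
    trajectory, and derivatives within [0, T] are unique. *)
Lemma material_derivativeP z d : S z ->
  is_material_derivative G0 T Phi phi z d <-> d = 'd tphi z (v z, 1).
Proof.
move=> Sz; have [X [GX tT zE]] := spacetimeP Sz; set t := z.2 in tT zE *.
have zEt : z = (z.1, t) by rewrite [LHS]surjective_pairing.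
pose c s := (Psi (X, s), s).
have ct : c t = z by rewrite /c PsiE// -zE -zEt.
have cz : is_derive t (1 : R) c (v z, 1).
  by have := trajectory_curve GX tT; rewrite -zE -zEt.
have dct : differentiable tphi (c t) by rewrite ct; exact: C1_near_diff Ctphi Sz.
have := is_derive_curve cz dct; rewrite ct => dc.
have agree s : 0 <= s <= T -> phi (Phi X s, s) = (tphi \o c) s.
  by move=> sT; rewrite /= /c PsiE// tphiE//; exact: spacetime_flow.
split => [[Y [GY YE dY]]|->].
  have YX : Y = X.
    by have [g [_ [_ _ _ gK]]] := inverse_flow tT; rewrite -(gK _ GY) YE zE gK.
  rewrite YX in dY; exact: within_derive_unique (es_time ES) tT agree dc dY.
exists X; split => //; exact: within_derive tT agree dc.
Qed.

(** Two extensions differ by a function that vanishes on the slice, hence is locally maximal at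
    every point of it, so [local_max_grad] kills the tangential part of its gradient. *)
Lemma tangential_gradientP z g : S z ->
  is_tangential_gradient (surface G0 Phi z.2) (nu z.1 z.2) (fun x => phi (x, z.2)) z.1 g
  <-> g = tangential_proj (nu z.1 z.2) (space_grad tphi z).
Proof.
move=> Sz; have [tT Gz] := Sz; have [U [oU SU Ctp]] := Ctphi.
have dt : differentiable tphi (z.1, z.2).
  by rewrite -surjective_pairing; exact: C1_near_diff Ctphi Sz.
split => [[ft [W [oW GW [dft _] ftE]] ->]|->]; last first.
  exists (fun x => tphi (x, z.2)) => //; exists [set x | U (x, z.2)]; split.
  - exact: slice_open.
  - by move=> x Gx; apply: SU.
  - exact: slice_C1.
  - by move=> x Gx; rewrite tphiE.
apply/eqP; rewrite -subr_eq0 -tangential_projB; apply/eqP.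
have df := dft _ (GW _ Gz).
have ds := slice_differentiable dt.
have -> : grad ft z.1 - space_grad tphi z = grad (fun y => ft y - tphi (y, z.2)) z.1.
  apply/rowP => j; rewrite mxE [X in _ + X]mxE !mxE.
  have d1 : derivable ft z.1 (delta_mx 0 j) by exact/diff_derivable.
  have d2 : derivable (fun y => tphi (y, z.2)) z.1 (delta_mx 0 j) by exact/diff_derivable.
  exact: (esym (deriveB d1 d2)).
apply: (local_max_grad (es_surface ES tT) Gz (normal_unit Sz)).
- by move=> w Tw; exact: normal_orth Sz Tw.
- exact: differentiableB.
rewrite near_withinE; apply: nearW => y Gy.
by rewrite !ftE// !tphiE// !subrr.
Qed.

End TestFunctions.

Local Notation subsol := (subsol S snd C1_near hj_operator).
Local Notation supersol := (supersol S snd C1_near hj_operator).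

Lemma C1_near_extension phi : Ck_on 1 S phi ->
  exists2 tphi, C1_near tphi & forall z, S z -> tphi z = phi z.
Proof. by move=> [g [U [oU SU Cg gE]]]; exists g => //; exists U. Qed.

Lemma Ck_on_C1_near phi : C1_near phi -> Ck_on 1 S phi.
Proof. by move=> [U [oU SU Cg]]; exists phi, U. Qed.

Lemma viscosity_subsol u0 u : viscosity_subsolution G0 T Phi nu H u0 u -> subsol u.
Proof.
move=> [_ uu _ test]; split; first exact/usc_onP.
move=> phi Cphi [x t] t0 mz; have [Sz _] := mz.
apply: (test phi (Ck_on_C1_near Cphi) x t t0 mz).
  by apply/(material_derivativeP Cphi).
by apply/(tangential_gradientP Cphi _ _ Sz).
Qed.

Lemma viscosity_supersol u0 u : viscosity_supersolution G0 T Phi nu H u0 u -> supersol u.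
Proof.
move=> [_ uu _ test]; split; first exact/lsc_onP.
move=> phi Cphi [x t] t0 mz; have [Sz _] := mz.
apply: (test phi (Ck_on_C1_near Cphi) x t t0 mz).
  by apply/(material_derivativeP Cphi).
by apply/(tangential_gradientP Cphi _ _ Sz).
Qed.

Lemma subsol_viscosity u0 u : locally_bounded_on S u -> subsol u ->
  (forall x, surface G0 Phi 0 x -> u (x, 0) <= u0 x) ->
  viscosity_subsolution G0 T Phi nu H u0 u.
Proof.
move=> bu [uu su] u0P; split => //; first exact/usc_onP.
move=> phi /C1_near_extension[tphi Ct tE] x t t0 [Sz mz] d g dd gg.
have -> : d = 'd tphi (x, t) (v (x, t), 1) by exact/(material_derivativeP Ct tE _ Sz).
have -> : g = tangential_proj (nu x t) (space_grad tphi (x, t)).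
  exact/(tangential_gradientP Ct tE _ Sz).
apply: (su _ Ct (x, t) t0); split => //.
move: mz; rewrite !near_withinE; apply: filterS => w wm Sw.
by rewrite !tE//; exact: wm.
Qed.

Lemma supersol_viscosity u0 u : locally_bounded_on S u -> supersol u ->
  (forall x, surface G0 Phi 0 x -> u0 x <= u (x, 0)) ->
  viscosity_supersolution G0 T Phi nu H u0 u.
Proof.
move=> bu [uu su] u0P; split => //; first exact/lsc_onP.
move=> phi /C1_near_extension[tphi Ct tE] x t t0 [Sz mz] d g dd gg.
have -> : d = 'd tphi (x, t) (v (x, t), 1) by exact/(material_derivativeP Ct tE _ Sz).
have -> : g = tangential_proj (nu x t) (space_grad tphi (x, t)).
  exact/(tangential_gradientP Ct tE _ Sz).
apply: (su _ Ct (x, t) t0); split => //.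
move: mz; rewrite !near_withinE; apply: filterS => w wm Sw.
by rewrite !tE//; exact: wm.
Qed.

Lemma hj_comparison u w : subsol u -> supersol w ->
  (forall x, surface G0 Phi 0 x -> u (x, 0) <= w (x, 0)) ->
  forall z, S z -> u z <= w z.
Proof.
move=> su sw uw0; apply: (@comparison R (V3 * R)%type S snd (@sqdist R) C1_near hj_operator
  spacetime_compact _ _ (@sqdist_sym R) (@sqdist_ge R) (@sqdist_le R) (@sqdist_continuous R) _
  C1_near_quad (@hj_operator_double) u w su sw).
- by move=> z [/andP[]].
- by move=> z w'; exact: (norm_snd_le (z - w')).
- by move=> phi Cphi z Sz; exact/differentiable_continuous/C1_near_diff.
- by move=> [x t] [_ Gx] /= t0; rewrite t0 in Gx *; exact: uw0.
Qed.

Lemma hj_existence u0 : {within surface G0 Phi 0, continuous u0} ->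
  exists u, [/\ subsol u, supersol u & forall x, surface G0 Phi 0 x -> u (x, 0) = u0 x].
Proof.
move=> cu0; have T0 := es_time ES.
have S0 x : surface G0 Phi 0 x -> S (x, 0) by split => //=; rewrite lexx ltW.
have [] := @perron R (V3 * R)%type S snd (@sqdist R) C1_near hj_operator spacetime_compact
  _ _ (@sqdist_sym R) (@sqdist_ge R) (@sqdist_le R) (@sqdist_continuous R) _
  C1_near_quad C1_near_add
  (fun phi Cphi z Sz e e0 => hj_operator_near Cphi Sz e0) (@hj_operator_quad) (@hj_operator_max) (@hj_operator_double) (fun z => u0 z.1) _ _.
- by move=> z [/andP[]].
- by move=> z w'; exact: (norm_snd_le (z - w')).
- by move=> phi Cphi z Sz; exact/differentiable_continuous/C1_near_diff.
- have [[X GX] _ _ _] := es_closed ES.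
  by exists (Phi X 0, 0); split => //; apply: S0; exists X.
- move=> [y t] [[_ Gy] /= t0] e e0; rewrite t0 in Gy *.
  have cy : u0 x @[x --> within (surface G0 Phi 0) (nbhs y)] --> u0 y.
    by move/subspace_continuousP : cu0 => /(_ _ Gy).
  move/cvgrPdist_lt : cy => /(_ _ e0) cy.
  have cy' : nbhs y [set x | surface G0 Phi 0 x -> `|u0 y - u0 x| < e] by [].
  have fy : nbhs (y, 0 : R) [set z : V3 * R | surface G0 Phi 0 z.1 -> `|u0 y - u0 z.1| < e].
    exact: (cvg_fst cy').
  rewrite near_withinE; apply: filterS fy => -[x s] /= h [[_ Gx] /= s0].
  by rewrite distrC; apply: h; rewrite s0 in Gx.
move=> u [su sw u0P]; exists u; split => // x Gx.
by rewrite (u0P (x, 0)) //; split => //; exact: S0.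
Qed.

Lemma viscosity_well_posed u0 : {within surface G0 Phi 0, continuous u0} ->
  exists u, viscosity_solution G0 T Phi nu H u0 u /\
    forall w, viscosity_solution G0 T Phi nu H u0 w -> forall z, S z -> w z = u z.
Proof.
move=> cu0; have [u [su sw u0P]] := hj_existence cu0.
(* Semicontinuity from both sides on the compact [S] bounds [u] above and below, which supplies the
   local boundedness absent from [subsol] and [supersol]. *)
have [M1 M1P] := compact_bounded_above spacetime_compact su.1.
have [M2 M2P] := compact_bounded_above spacetime_compact sw.1.
have bu : locally_bounded_on S u.
  move=> z Sz; exists (Num.max M1 M2); rewrite near_withinE; apply: nearW => y Sy.
  by rewrite ler_norml le_max M1P// lerNl le_max M2P// orbT.
exists u; split.
  split; first by apply: subsol_viscosity => // x Gx; rewrite u0P.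
  by apply: supersol_viscosity => // x Gx; rewrite u0P.
move=> w [wsub wsup] z Sz; apply/eqP; rewrite eq_le; apply/andP; split.
  apply: hj_comparison (viscosity_subsol wsub) sw _ z Sz => x Gx; rewrite u0P//.
  by have [_ _ w0 _] := wsub; exact: w0.
apply: hj_comparison su (viscosity_supersol wsup) _ z Sz => x Gx; rewrite u0P//.
by have [_ _ w0 _] := wsup; exact: w0.
Qed.

End EvolvingSurface.

Theorem theorem5p1 (R : realType) (G0 : set 'rV[R]_3) (T : R)
    (Phi : 'rV[R]_3 -> R -> 'rV[R]_3) (v : 'rV[R]_3 * R -> 'rV[R]_3)
    (nu : 'rV[R]_3 -> R -> 'rV[R]_3)
    (H : 'rV[R]_3 * R -> 'rV[R]_3 -> R) (L1 L2 : R)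
    (u0 : 'rV[R]_3 -> R) :
  evolving_surface G0 T Phi v nu ->
  0 < L1 -> 0 < L2 ->
  hamiltonian_conditions (spacetime G0 T Phi) H L1 L2 ->
  {within surface G0 Phi 0, continuous u0} ->
  exists u : 'rV[R]_3 * R -> R,
    viscosity_solution G0 T Phi nu H u0 u /\
    forall w : 'rV[R]_3 * R -> R, viscosity_solution G0 T Phi nu H u0 w ->
      forall z, spacetime G0 T Phi z -> w z = u z.
Proof.
move=> ES L1_gt0 L2_gt0 HC cu0.
have [Psi [U [oU GU PsiC PsiE]]] := es_flow_smooth ES.
apply: (viscosity_well_posed ES oU _ PsiC _ L1_gt0 L2_gt0 HC cu0).
- by move=> X t GX tT; apply: GU; split => //=; rewrite in_itv.
- by move=> X t GX tT; rewrite PsiE//; split => //=; rewrite in_itv.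
Qed.
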